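(* Suppose $(\mathcal C,\alpha)$ is a grading category admitting a looper $\varepsilon$, and fix the triple $(\mathcal C,\alpha,\varepsilon)$. Then the zeroth Hochschild homology $$\langle\!\langle-\rangle\!\rangle_A:=\mathsf{HH}_0(A,-)$$ is a symmetric shadow with target category $\mathbf T=\mathrm{Mod}^{\mathrm{Tr}(\mathcal C)}$ on the bicategory $\mathcal B=\mathrm{Bim}^{\mathcal C}$.
   Context: Let $\Bbbk$ be a commutative unital ring with unit group $\Bbbk^\times$ and $\mathcal C$ a small category. A grading category is a pair $(\mathcal C,\alpha)$ where $\alpha$ assigns to each composable triple $(f_1,f_2,f_3)$ (so $f_3\circ f_2\circ f_1$ is defined) an element of $\Bbbk^\times$ such that for all composable $(f_1,f_2,f_3,f_4)$: $\alpha(f_1,f_2,f_3)\,\alpha(f_1,f_2,f_4\circ f_3)^{-1}\alpha(f_1,f_3\circ f_2,f_4)\,\alpha(f_2\circ f_1,f_3,f_4)^{-1}\alpha(f_2,f_3,f_4)=1$. A $\mathcal C$-graded module is a $\Bbbk$-module $M=\bigoplus_{g\in\mathrm{Mor}(\mathcal C)}M_g$; write $|x|=g$ for $x\in M_g$. Graded maps are $\Bbbk$-linear and preserve each $M_g$. The tensor product is $(M\otimes N)_g=\bigoplus_{g=g_2\circ g_1}M_{g_1}\otimes_\Bbbk N_{g_2}$ (tensors and products of elements with non-composable degrees are zero), with associator $(x\otimes y)\otimes z\mapsto\alpha(|x|,|y|,|z|)\,x\otimes(y\otimes z)$. Unitor constants: for $g:X\to Y$, $\mathcal L(\mathrm{Id}_X,g)=\alpha(\mathrm{Id}_X,\mathrm{Id}_X,g)^{-1}$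 and $\mathcal R(g,\mathrm{Id}_Y)=\alpha(g,\mathrm{Id}_Y,\mathrm{Id}_Y)$. A $\mathcal C$-graded algebra is a $\mathcal C$-graded module $A$ with a graded $\Bbbk$-linear $\mu:A\otimes A\to A$ and elements $1_X\in A_{\mathrm{Id}_X}$ with, for homogeneous elements, $\mu(\mu(x,y),z)=\alpha(|x|,|y|,|z|)\mu(x,\mu(y,z))$, $\mu(1_X,x)=\mathcal L(\mathrm{Id}_X,|x|)x$, $\mu(x,1_Y)=\mathcal R(|x|,\mathrm{Id}_Y)x$ if $|x|:X\to Y$. A $\mathcal C$-graded $(A,B)$-bimodule is a $\mathcal C$-graded module $M$ with graded $\Bbbk$-linear maps $\rho_L:A\otimes M\to M$, $\rho_R:M\otimes B\to M$ such that, for homogeneous elements, $\rho_L(\mu_A(a,a'),m)=\alpha(|a|,|a'|,|m|)\rho_L(a,\rho_L(a',m))$, $\rho_R(\rho_R(m,b),b')=\alpha(|m|,|b|,|b'|)\rho_R(m,\mu_B(b,b'))$, $\rho_R(\rho_L(a,m),b)=\alpha(|a|,|m|,|b|)\rho_L(a,\rho_R(m,b))$, and $\rho_L(1_X,m)=\mathcal L(\mathrm{Id}_X,|m|)m$, $\rho_R(m,1_Y)=\mathcal R(|m|,\mathrm{Id}_Y)m$ for $|m|:X\to Y$. A looper for $(\mathcal C,\alpha)$ is a function $\varepsilon$ assigning to each pair $f:X\to Y$, $g:Y\to X$ an element of $\Bbbk^\times$ with $\varepsilon(f,g)^{-1}=\varepsilon(g,f)$ and, for every loop $h\circ g\circ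 f$ of length three, $\alpha(f,g,h)\varepsilon(f,h\circ g)\,\alpha(g,h,f)\varepsilon(g,f\circ h)\,\alpha(h,f,g)\varepsilon(h,g\circ f)=1$. $\mathrm{Tr}(\mathcal C)$ is $\coprod_X\mathrm{End}_{\mathcal C}(X)$ modulo the equivalence relation generated by $g\circ f\sim f\circ g$ for $f:X\to Y$, $g:Y\to X$; $\mathrm{Mod}^{\mathrm{Tr}(\mathcal C)}$ is the category of $\Bbbk$-modules graded by the set $\mathrm{Tr}(\mathcal C)$ with grading-preserving $\Bbbk$-linear maps. For a $\mathcal C$-graded $(A,A)$-bimodule $M$, $\mathsf{HH}_0(A,M)=M/\langle\rho_R(m,a)-\varepsilon(|m|,|a|)\rho_L(a,m)\rangle$ over homogeneous $a\in A$, $m\in M$ (a term whose degrees are not composable is $0$; hence elements whose degree is not an endomorphism die), graded by the class of $|m|$ in $\mathrm{Tr}(\mathcal C)$. $\mathrm{Bim}^{\mathcal C}$ is the bicategory whose objects are $\mathcal C$-graded algebras, whose category of morphisms from $A$ to $B$ is the category of $\mathcal C$-graded $(A,B)$-bimodules and graded bimodule maps, with composition $M\odot N=M\otimes_BN:=M\otimes N/\big(\rho_R(m,b)\otimes n-\alpha(|m|,|b|,|n|)\,m\otimes\rho_L(b,n)\big)$ (with actions $\rho_L(a,m\otimes n)=\alpha(|a|,|m|,|n|)^{-1}\rho_L(a,m)\otimes n$, $\rho_R(m\otimes n,c)=\alpha(|m|,|n|,|c|)\,m\otimes\rho_R(n,c)$), associator $\mathfrak a$ induced by $\alpha$, identity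 $1$-morphism of $A$ given by $A$ as a bimodule over itself, and unitors $\mathfrak l:a\otimes m\mapsto\rho_L(a,m)$, $\mathfrak r:m\otimes a\mapsto\rho_R(m,a)$. A shadow for a bicategory $\mathcal B$ with target category $\mathbf T$ is a family of functors $\langle\!\langle-\rangle\!\rangle_X:\mathrm{End}_{\mathcal B}(X)\to\mathbf T$ ($X\in\mathrm{Ob}(\mathcal B)$) equipped with natural isomorphisms $\theta_{f,g}:\langle\!\langle f\odot g\rangle\!\rangle_X\to\langle\!\langle g\odot f\rangle\!\rangle_Y$ for $f:X\to Y$, $g:Y\to X$ such that, whenever they make sense, $\langle\!\langle\mathfrak a\rangle\!\rangle\circ\theta_{f,g\odot h}\circ\langle\!\langle\mathfrak a\rangle\!\rangle=\theta_{h\odot f,g}\circ\langle\!\langle\mathfrak a^{-1}\rangle\!\rangle\circ\theta_{f\odot g,h}$ as maps $\langle\!\langle(f\odot g)\odot h\rangle\!\rangle\to\langle\!\langle g\odot(h\odot f)\rangle\!\rangle$, and $\langle\!\langle\mathfrak l\rangle\!\rangle\circ\theta_{f,\mathrm{Id}_X}=\langle\!\langle\mathfrak r\rangle\!\rangle$, $\langle\!\langle\mathfrak r\rangle\!\rangle\circ\theta_{\mathrm{Id}_X,f}=\langle\!\langle\mathfrak l\rangle\!\rangle$. The shadow is symmetric if $\theta_{f,g}^{-1}=\theta_{g,f}$. *)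

(* Defs.v *)
From HB Require Import structures.
From mathcomp Require Import all_boot all_algebra boolp ring.

Set Implicit Arguments.
Unset Strict Implicit.
Unset Printing Implicit Defensive.

Import GRing.Theory.
Local Open Scope ring_scope.
Local Open Scope quotient_scope.

Declare Scope cat_scope.
Delimit Scope cat_scope with cat.
Local Open Scope cat_scope.

Section PropQuotient.
Variables (T : Type) (E : T -> T -> Prop).
Hypotheses (Erefl : forall x, E x x)
  (Esym : forall x y, E x y -> E y x)
  (Etrans : forall x y z, E x y -> E y z -> E x z).

Definition prop_rel : rel {classic T} := fun x y => `[< E x y >].

Lemma prop_rel_refl : reflexive prop_rel.
Proof. by move=> x; apply/asboolP; exact: Erefl. Qed.

Lemma prop_rel_sym : symmetric prop_rel.
Proof.
by move=> x y; apply/idP/idP => /asboolP h; apply/asboolP; exact: Esym.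
Qed.

Lemma prop_rel_trans : transitive prop_rel.
Proof.
move=> y x z /asboolP h1 /asboolP h2; apply/asboolP; exact: Etrans h1 h2.
Qed.

Definition prop_equiv : equiv_rel {classic T} :=
  EquivRel prop_rel prop_rel_refl prop_rel_sym prop_rel_trans.

End PropQuotient.

(** The [k]-module with generators [G] and relations [x = y] for [R x y], built
    as formal linear combinations modulo the generated congruence; [pres_rel],
    [plift_gen], [plift_linear] and [pres_ext] are its universal property. *)
Section Presentation.
Variables (k : comPzRingType) (G : Type).

Inductive lterm : Type :=
| LZero
| LGen of G
| LAdd of lterm & lterm
| LScale of k & lterm.

Variable R : lterm -> lterm -> Prop.

Inductive lcong : lterm -> lterm -> Prop :=
| lc_refl x : lcong x x
| lc_sym x y : lcong x y -> lcong y x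
| lc_trans x y z : lcong x y -> lcong y z -> lcong x z
| lc_add x x' y y' : lcong x x' -> lcong y y' -> lcong (LAdd x y) (LAdd x' y')
| lc_scale a x x' : lcong x x' -> lcong (LScale a x) (LScale a x')
| lc_addA x y z : lcong (LAdd x (LAdd y z)) (LAdd (LAdd x y) z)
| lc_addC x y : lcong (LAdd x y) (LAdd y x)
| lc_add0 x : lcong (LAdd LZero x) x
| lc_addN x : lcong (LAdd (LScale (-1) x) x) LZero
| lc_scaleA a b x : lcong (LScale a (LScale b x)) (LScale (a * b) x)
| lc_scale1 x : lcong (LScale 1 x) x
| lc_scaleDr a x y :
    lcong (LScale a (LAdd x y)) (LAdd (LScale a x) (LScale a y))
| lc_scaleDl a b x :
    lcong (LScale (a + b) x) (LAdd (LScale a x) (LScale b x))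
| lc_rel x y : R x y -> lcong x y.

Definition lcong_equiv := prop_equiv lc_refl lc_sym lc_trans.

Definition pres := {eq_quot lcong_equiv}.
HB.instance Definition _ := Choice.on pres.

Definition pcls (x : lterm) : pres := \pi_pres (x : {classic lterm}).
Definition prep (x : pres) : lterm := repr x.

Lemma prepK x : pcls (prep x) = x.
Proof. exact: reprK. Qed.

Lemma pclsE x y : pcls x = pcls y <-> lcong x y.
Proof.
split=> [/eqmodP/asboolP //|h]; apply/eqmodP; exact/asboolP.
Qed.

Lemma pclsK x : lcong (prep (pcls x)) x.
Proof. by apply/pclsE; rewrite prepK. Qed.

Definition pzero : pres := pcls LZero.
Definition padd (x y : pres) : pres := pcls (LAdd (prep x) (prep y)).
Definition pscale (a : k) (x : pres) : pres := pcls (LScale a (prep x)).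

Lemma paddE x y : padd (pcls x) (pcls y) = pcls (LAdd x y).
Proof. by apply/pclsE; apply: lc_add; apply: pclsK. Qed.

Lemma pscaleE a x : pscale a (pcls x) = pcls (LScale a x).
Proof. by apply/pclsE; apply: lc_scale; apply: pclsK. Qed.

Lemma pclsP (P : pres -> Prop) : (forall x, P (pcls x)) -> forall x, P x.
Proof. by move=> h x; rewrite -(prepK x). Qed.

Lemma paddA : associative padd.
Proof.
elim/pclsP=> x; elim/pclsP=> y; elim/pclsP=> z; rewrite !paddE; apply/pclsE.
exact: lc_addA.
Qed.

Lemma paddC : commutative padd.
Proof.
elim/pclsP=> x; elim/pclsP=> y; rewrite !paddE; apply/pclsE; exact: lc_addC.
Qed.

Lemma padd0 : left_id pzero padd.
Proof. elim/pclsP=> x; rewrite paddE; apply/pclsE; exact: lc_add0. Qed.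

Lemma paddN : left_inverse pzero (pscale (-1)) padd.
Proof.
elim/pclsP=> x; rewrite pscaleE paddE; apply/pclsE; exact: lc_addN.
Qed.

HB.instance Definition _ := GRing.isZmodule.Build pres paddA paddC padd0 paddN.

Lemma pscaleA a b v : pscale a (pscale b v) = pscale (a * b) v.
Proof. elim/pclsP: v => x; rewrite !pscaleE; apply/pclsE; exact: lc_scaleA. Qed.

Lemma pscale1 : left_id 1 pscale.
Proof. elim/pclsP=> x; rewrite pscaleE; apply/pclsE; exact: lc_scale1. Qed.

Lemma pscaleDr : right_distributive pscale +%R.
Proof.
move=> a; elim/pclsP=> x; elim/pclsP=> y.
rewrite /GRing.add /= paddE !pscaleE paddE; apply/pclsE; exact: lc_scaleDr.
Qed.

Lemma pscaleDl v : {morph pscale^~ v : a b / a + b}.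
Proof.
move=> a b /=; elim/pclsP: v => x.
rewrite !pscaleE {2}/GRing.add /= paddE; apply/pclsE; exact: lc_scaleDl.
Qed.

HB.instance Definition _ :=
  GRing.Zmodule_isLmodule.Build k pres pscaleA pscale1 pscaleDr pscaleDl.

Definition pgen (g : G) : pres := pcls (LGen g).

Fixpoint leval (V : lmodType k) (f : G -> V) (x : lterm) : V :=
  match x with
  | LZero => 0
  | LGen g => f g
  | LAdd x y => leval f x + leval f y
  | LScale a x => a *: leval f x
  end.

Lemma pcls_eval x : pcls x = leval pgen x.
Proof.
elim: x => //= [x <- y <-|a x <-]; first by rewrite /GRing.add /= paddE.
by rewrite /GRing.scale /= pscaleE.
Qed.

Lemma pres_rel x y : R x y -> leval pgen x = leval pgen y.
Proof. by move=> h; rewrite -!pcls_eval; apply/pclsE; exact: lc_rel. Qed.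

Lemma pres_ind (P : pres -> Prop) :
  P 0 -> (forall g, P (pgen g)) -> (forall x y, P x -> P y -> P (x + y)) ->
  (forall a x, P x -> P (a *: x)) -> forall x, P x.
Proof.
move=> h0 hg ha hs; elim/pclsP; elim=> [|g|x Px y Py|a x Px]; first exact: h0.
- exact: hg.
- by rewrite pcls_eval /= -!pcls_eval; exact: ha.
- by rewrite pcls_eval /= -!pcls_eval; exact: hs.
Qed.

Section Lift.
Variables (V : lmodType k) (f : G -> V).

Definition compat := forall x y, R x y -> leval f x = leval f y.

Definition plift_fun (x : pres) : V := leval f (prep x).
Definition plift (_ : compat) := plift_fun.

Hypothesis hf : compat.

Lemma leval_cong x y : lcong x y -> leval f x = leval f y.
Proof.
elim=> //=.
- by move=> {}x {}y z _ -> _ ->.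
- by move=> ? ? ? ? _ -> _ ->.
- by move=> ? ? ? _ ->.
- by move=> *; rewrite addrA.
- by move=> *; rewrite addrC.
- by move=> *; rewrite add0r.
- by move=> *; rewrite scaleN1r addNr.
- by move=> *; rewrite scalerA.
- by move=> *; rewrite scale1r.
- by move=> *; rewrite scalerDr.
- by move=> *; rewrite scalerDl.
Qed.

Lemma plift_cls x : plift hf (pcls x) = leval f x.
Proof. exact/leval_cong/pclsK. Qed.

Lemma plift_gen g : plift hf (pgen g) = f g.
Proof. exact: plift_cls. Qed.

Lemma plift_linear : linear (plift hf).
Proof.
move=> a; elim/pclsP=> x; elim/pclsP=> y.
have -> : a *: pcls x + pcls y = pcls (LAdd (LScale a x) y).
  by rewrite !pcls_eval.
by rewrite !plift_cls.
Qed.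

End Lift.
End Presentation.

Arguments plift : simpl never.
Arguments plift_fun : simpl never.

Arguments LZero {k G}.

Section LinearPredicate.
Variable k : comPzRingType.

Lemma lin0 (U V : lmodType k) (f : U -> V) : linear f -> f 0 = 0.
Proof. by move=> h; have := h (-1) 0 0; rewrite scaler0 addr0 scaleN1r addNr. Qed.

Lemma linD (U V : lmodType k) (f : U -> V) : linear f -> {morph f : x y / x + y}.
Proof. by move=> h x y; have := h 1 x y; rewrite !scale1r. Qed.

Lemma linZ (U V : lmodType k) (f : U -> V) :
  linear f -> forall a, {morph f : x / a *: x}.
Proof. by move=> h a x; have := h a x 0; rewrite !addr0 (lin0 h) addr0. Qed.

Lemma lin_id (U : lmodType k) : linear (fun x : U => x).
Proof. by []. Qed.

Lemma lin_comp (U V W : lmodType k) (f : V -> W) (g : U -> V) :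
  linear f -> linear g -> linear (fun x => f (g x)).
Proof. by move=> hf hg a x y; rewrite hg hf. Qed.

Lemma lin_scale (U V : lmodType k) (c : k) (f : U -> V) :
  linear f -> linear (fun x => c *: f x).
Proof.
by move=> hf a x y; rewrite hf scalerDr !scalerA (mulrC c a).
Qed.

Lemma pres_ext (G : Type) (R : lterm k G -> lterm k G -> Prop)
    (V : lmodType k) (f g : pres R -> V) :
  linear f -> linear g -> (forall x, f (pgen R x) = g (pgen R x)) -> f =1 g.
Proof.
move=> hf hg h; elim/pres_ind=> [|//|x y e1 e2|a x e].
- by rewrite !lin0.
- by rewrite !linD // e1 e2.
- by rewrite !linZ // e.
Qed.

Lemma plift_lin2 (U : lmodType k) (G : Type) (R : lterm k G -> lterm k G -> Prop)
    (V : lmodType k) (f : U -> G -> V) (hf : forall u, compat R (f u)) :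
  (forall g, linear (f^~ g)) -> forall x, linear (fun u => plift (hf u) x).
Proof.
move=> h x a u v; elim/pres_ind: x => [|g|x y e1 e2|b x e].
- by rewrite !(lin0 (plift_linear _)) scaler0 addr0.
- by rewrite !plift_gen h.
- by rewrite !(linD (plift_linear _)) e1 e2 scalerDr addrACA.
- by rewrite !(linZ (plift_linear _)) e scalerDr !scalerA (mulrC a b).
Qed.

End LinearPredicate.

(** Kept apart from [category] below, whose objects may be as large as the
    collection of all modules; the objects and morphisms of a [smallCat] index
    direct sums of modules. *)
Record smallCat := SmallCat {
  sob :> Type;
  smor : sob -> sob -> Type;
  sid : forall X, smor X X;
  scomp : forall X Y Z, smor Y Z -> smor X Y -> smor X Z;
  scompA : forall X Y Z W (f : smor X Y) (g : smor Y Z) (h : smor Z W),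
    scomp h (scomp g f) = scomp (scomp h g) f;
  scompIf : forall X Y (f : smor X Y), scomp (sid Y) f = f;
  scompfI : forall X Y (f : smor X Y), scomp f (sid X) = f
}.
Arguments smor {s}.
Arguments sid {s}.
Notation "g ∘ f" := (scomp g f) (at level 40, left associativity) : cat_scope.

Record category := Category {
  cob :> Type;
  chom : cob -> cob -> Type;
  cid : forall x, chom x x;
  ccomp : forall x y z, chom y z -> chom x y -> chom x z;
  ccompA : forall x y z w (f : chom x y) (g : chom y z) (h : chom z w),
    ccomp h (ccomp g f) = ccomp (ccomp h g) f;
  ccompIf : forall x y (f : chom x y), ccomp (cid y) f = f;
  ccompfI : forall x y (f : chom x y), ccomp f (cid x) = f
}.
Arguments chom {c}.
Arguments cid {c}.
Notation "g ∙ f" := (ccomp g f) (at level 40, left associativity) : cat_scope.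

Record iso (T : category) (x y : T) := Iso {
  ifwd :> chom x y;
  ibwd : chom y x;
  ifwdK : ibwd ∙ ifwd = cid x;
  ibwdK : ifwd ∙ ibwd = cid y
}.

Record functor (S T : category) := Functor {
  fobj :> S -> T;
  fmap : forall x y, chom x y -> chom (fobj x) (fobj y);
  fmap_id : forall x, fmap (cid x) = cid (fobj x);
  fmap_comp : forall x y z (f : chom x y) (g : chom y z),
    fmap (g ∙ f) = fmap g ∙ fmap f
}.
Arguments fmap {S T} _ {x y}.

Definition prodcat (S T : category) : category.
Proof.
refine (@Category (S * T)%type
  (fun x y => (chom x.1 y.1 * chom x.2 y.2)%type)
  (fun x => (cid x.1, cid x.2))
  (fun x y z g f => (g.1 ∙ f.1, g.2 ∙ f.2)) _ _ _).
- by move=> *; rewrite /= !ccompA.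
- by move=> x y [f g]; rewrite /= !ccompIf.
- by move=> x y [f g]; rewrite /= !ccompfI.
Defined.

(** The composite of 1-morphisms is written diagrammatically: [f ⊙ g] is
    [f : X -> Y] followed by [g : Y -> Z]. *)
Record bicatData := BicatData {
  b0 :> Type;
  b1 : b0 -> b0 -> category;
  bid : forall X, b1 X X;
  bcomp : forall X Y Z, functor (prodcat (b1 X Y) (b1 Y Z)) (b1 X Z);
  bassoc : forall X Y Z W (f : b1 X Y) (g : b1 Y Z) (h : b1 Z W),
    iso (bcomp X Z W (bcomp X Y Z (f, g), h))
        (bcomp X Y W (f, bcomp Y Z W (g, h)));
  blunit : forall X Y (f : b1 X Y), iso (bcomp X X Y (bid X, f)) f;
  brunit : forall X Y (f : b1 X Y), iso (bcomp X Y Y (f, bid Y)) f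
}.
Arguments b1 {b}.
Arguments bid {b}.
Arguments bcomp {b X Y Z}.
Arguments bassoc {b X Y Z W}.
Arguments blunit {b X Y}.
Arguments brunit {b X Y}.

Notation "f ⊙ g" := (bcomp (f, g)) (at level 35, right associativity) : cat_scope.

Definition bcomp2 (B : bicatData) (X Y Z : B) (f f' : b1 X Y) (g g' : b1 Y Z)
    (u : chom f f') (v : chom g g') : chom (f ⊙ g) (f' ⊙ g') :=
  @fmap _ _ (@bcomp B X Y Z) (f, g) (f', g') (u, v).
Notation "u ⊛ v" := (bcomp2 u v) (at level 35, right associativity) : cat_scope.

Record bicategory := Bicategory {
  bdata :> bicatData;
  bassoc_nat : forall (X Y Z W : bdata) (f f' : b1 X Y) (g g' : b1 Y Z)
      (h h' : b1 Z W) (u : chom f f') (v : chom g g') (w : chom h h'),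
    bassoc f' g' h' ∙ ((u ⊛ v) ⊛ w) = (u ⊛ (v ⊛ w)) ∙ bassoc f g h;
  blunit_nat : forall (X Y : bdata) (f f' : b1 X Y) (u : chom f f'),
    blunit f' ∙ (cid (bid X) ⊛ u) = u ∙ blunit f;
  brunit_nat : forall (X Y : bdata) (f f' : b1 X Y) (u : chom f f'),
    brunit f' ∙ (u ⊛ cid (bid Y)) = u ∙ brunit f;
  bpentagon : forall (X Y Z W V : bdata) (f : b1 X Y) (g : b1 Y Z) (h : b1 Z W)
      (l : b1 W V),
    bassoc f g (h ⊙ l) ∙ bassoc (f ⊙ g) h l =
    (cid f ⊛ bassoc g h l) ∙ bassoc f (g ⊙ h) l ∙ (bassoc f g h ⊛ cid l);
  btriangle : forall (X Y Z : bdata) (f : b1 X Y) (g : b1 Y Z),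
    (cid f ⊛ blunit g) ∙ bassoc f (bid Y) g = brunit f ⊛ cid g
}.

Record shadow (B : bicategory) (T : category)
    (sh : forall X : B, functor (b1 X X) T) := Shadow {
  sh_theta : forall (X Y : B) (f : b1 X Y) (g : b1 Y X),
    iso (sh X (f ⊙ g)) (sh Y (g ⊙ f));
  sh_theta_nat : forall (X Y : B) (f f' : b1 X Y) (g g' : b1 Y X)
      (u : chom f f') (v : chom g g'),
    sh_theta f' g' ∙ fmap (sh X) (u ⊛ v) = fmap (sh Y) (v ⊛ u) ∙ sh_theta f g;
  sh_hexagon : forall (X Y Z : B) (f : b1 X Y) (g : b1 Y Z) (h : b1 Z X),
    fmap (sh Y) (bassoc g h f) ∙ sh_theta f (g ⊙ h) ∙ fmap (sh X) (bassoc f g h)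
    = sh_theta (h ⊙ f) g ∙ fmap (sh Z) (ibwd (bassoc h f g))
      ∙ sh_theta (f ⊙ g) h;
  sh_lunit : forall (X : B) (f : b1 X X),
    fmap (sh X) (blunit f) ∙ sh_theta f (bid X) = fmap (sh X) (brunit f);
  sh_runit : forall (X : B) (f : b1 X X),
    fmap (sh X) (brunit f) ∙ sh_theta (bid X) f = fmap (sh X) (blunit f)
}.
Arguments sh_theta {B T sh} s {X Y}.

Definition symmetric_shadow (B : bicategory) (T : category)
    (sh : forall X : B, functor (b1 X X) T) (S : shadow sh) :=
  forall (X Y : B) (f : b1 X Y) (g : b1 Y X),
    ibwd (sh_theta S f g) = sh_theta S g f.

(** A [comPzRingType] may be the zero ring and carries no unit predicate, so a
    unit comes with its inverse. *)
Record kunit (k : comPzRingType) := KUnit {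
  uval : k;
  uinv : k;
  uvalK : uval * uinv = 1
}.

Record gradingCat (k : comPzRingType) := GradingCat {
  gcat :> smallCat;
  galpha : forall X Y Z W : gcat, smor X Y -> smor Y Z -> smor Z W -> kunit k;
  galpha_cocycle : forall (X1 X2 X3 X4 X5 : gcat)
      (f1 : smor X1 X2) (f2 : smor X2 X3) (f3 : smor X3 X4) (f4 : smor X4 X5),
    uval (galpha f1 f2 f3) * uinv (galpha f1 f2 (f4 ∘ f3))
    * uval (galpha f1 (f3 ∘ f2) f4) * uinv (galpha (f2 ∘ f1) f3 f4)
    * uval (galpha f2 f3 f4) = 1
}.

Record looper (k : comPzRingType) (C : gradingCat k) := Looper {
  leps : forall X Y : C, smor X Y -> smor Y X -> kunit k;
  leps_inv : forall (X Y : C) (f : smor X Y) (g : smor Y X),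
    uinv (leps f g) = uval (leps g f);
  leps_loop : forall (X Y Z : C) (f : smor X Y) (g : smor Y Z) (h : smor Z X),
    uval (galpha f g h) * uval (leps f (h ∘ g))
    * (uval (galpha g h f) * uval (leps g (f ∘ h)))
    * (uval (galpha h f g) * uval (leps h (g ∘ f))) = 1
}.
Arguments leps {k C} l {X Y}.

Section Trace.
Variable C : smallCat.

Definition endo := {X : C & smor X X}.
Definition Endo (X : C) (f : smor X X) : endo := existT (fun X => smor X X) X f.

Inductive tr_eq : endo -> endo -> Prop :=
| tr_swap X Y (f : smor X Y) (g : smor Y X) : tr_eq (Endo (g ∘ f)) (Endo (f ∘ g))
| tr_refl x : tr_eq x x
| tr_sym x y : tr_eq x y -> tr_eq y x
| tr_trans x y z : tr_eq x y -> tr_eq y z -> tr_eq x z.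

Definition tr_equiv := prop_equiv tr_refl tr_sym tr_trans.
Definition Tr := {eq_quot tr_equiv}.
Definition tr (X : C) (f : smor X X) : Tr := \pi_Tr (Endo f : {classic endo}).

Lemma trP X Y (f : smor X X) (g : smor Y Y) :
  tr f = tr g <-> tr_eq (Endo f) (Endo g).
Proof.
split=> [/eqmodP/asboolP //|h]; apply/eqmodP; exact/asboolP.
Qed.

Lemma tr_comm X Y (f : smor X Y) (g : smor Y X) : tr (g ∘ f) = tr (f ∘ g).
Proof. exact/trP/tr_swap. Qed.

End Trace.

Section GradedSet.
Variables (k : comPzRingType) (S : Type).

Record modMap (M N : S -> lmodType k) := ModMap {
  mm_fun :> forall s, M s -> N s;
  mm_lin : forall s, linear (@mm_fun s)
}.

Lemma modMapP (M N : S -> lmodType k) (u v : modMap M N) :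
  (forall s x, u s x = v s x) -> u = v.
Proof.
case: u v => [u hu] [v hv] /= h.
have e : u = v by apply: functional_extensionality_dep => s; exact/funext.
by subst v; congr ModMap; exact: Prop_irrelevance.
Qed.

Definition modId M : modMap M M := ModMap (fun s => @lin_id _ (M s)).
Definition modComp M N P (v : modMap N P) (u : modMap M N) : modMap M P :=
  ModMap (fun s => lin_comp (@mm_lin _ _ v s) (@mm_lin _ _ u s)).

Definition GrMod : category.
Proof.
by refine (@Category (S -> lmodType k) modMap modId modComp _ _ _);
   move=> *; exact: modMapP.
Defined.

End GradedSet.

Section Graded.
Variables (k : comPzRingType) (C : gradingCat k).

Definition Lc (X Y : C) (g : smor X Y) : k := uinv (galpha (sid X) (sid X) g).
Definition Rc (X Y : C) (g : smor X Y) : k := uval (galpha g (sid Y) (sid Y)).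

(** A [C]-graded module is the direct sum of the family of its homogeneous
    components. *)
Record gmod := GMod { gpart :> forall X Y : C, smor X Y -> lmodType k }.

(** A graded linear map [M ⊗ N -> P] amounts to bilinear maps
    [M_f x N_g -> P_(g ∘ f)]. They are indexed by a proof of [g ∘ f = h] so that
    both sides of an associativity law live in one module, with no transport
    along associativity of composition. *)
Definition gbilin (M N P : gmod) :=
  forall (X Y Z : C) (f : smor X Y) (g : smor Y Z) (h : smor X Z),
    g ∘ f = h -> M _ _ f -> N _ _ g -> P _ _ h.

Definition is_gbilin (M N P : gmod) (mu : gbilin M N P) :=
  forall (X Y Z : C) (f : smor X Y) (g : smor Y Z) (h : smor X Z)
    (e : g ∘ f = h),
    (forall y, linear (fun x => mu _ _ _ _ _ _ e x y))
    /\ (forall x, linear (mu _ _ _ _ _ _ e x)).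

Definition gassoc (M N P MN NP Q : gmod) (l1 : gbilin M N MN)
    (r1 : gbilin MN P Q) (r2 : gbilin M NP Q) (l2 : gbilin N P NP) :=
  forall (X Y Z W : C) (f : smor X Y) (g : smor Y Z) (h : smor Z W)
    (gf : smor X Z) (hg : smor Y W) (q : smor X W)
    (e1 : g ∘ f = gf) (e2 : h ∘ gf = q) (e3 : h ∘ g = hg) (e4 : hg ∘ f = q)
    (x : M _ _ f) (y : N _ _ g) (z : P _ _ h),
    r1 _ _ _ _ _ _ e2 (l1 _ _ _ _ _ _ e1 x y) z
    = uval (galpha f g h) *: r2 _ _ _ _ _ _ e4 x (l2 _ _ _ _ _ _ e3 y z).

Record galg := GAlg {
  gamod :> gmod;
  gmul : gbilin gamod gamod gamod;
  gone : forall X : C, gamod _ _ (sid X);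
  gmul_bilin : is_gbilin gmul;
  gmulA : gassoc gmul gmul gmul gmul;
  gmul1l : forall (X Y : C) (f : smor X Y) (e : f ∘ sid X = f)
      (x : gamod _ _ f),
    gmul e (gone X) x = Lc f *: x;
  gmul1r : forall (X Y : C) (f : smor X Y) (e : sid Y ∘ f = f)
      (x : gamod _ _ f),
    gmul e x (gone Y) = Rc f *: x
}.

Record gbimod (A B : galg) := GBimod {
  bmmod :> gmod;
  lact : gbilin A bmmod bmmod;
  ract : gbilin bmmod B bmmod;
  lact_bilin : is_gbilin lact;
  ract_bilin : is_gbilin ract;
  lactA : gassoc (@gmul A) lact lact lact;
  ractA : gassoc ract ract ract (@gmul B);
  lractA : gassoc lact ract lact ract;
  lact1 : forall (X Y : C) (f : smor X Y) (e : f ∘ sid X = f) (m : bmmod _ _ f),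
    lact e (gone A X) m = Lc f *: m;
  ract1 : forall (X Y : C) (f : smor X Y) (e : sid Y ∘ f = f) (m : bmmod _ _ f),
    ract e m (gone B Y) = Rc f *: m
}.

Record bimap (A B : galg) (M N : gbimod A B) := BiMap {
  bm_fun :> forall (X Y : C) (f : smor X Y), M _ _ f -> N _ _ f;
  bm_lin : forall (X Y : C) (f : smor X Y), linear (@bm_fun X Y f);
  bm_lact : forall (X Y Z : C) (f : smor X Y) (g : smor Y Z) (h : smor X Z)
      (e : g ∘ f = h) (a : A _ _ f) (m : M _ _ g),
    bm_fun (lact e a m) = lact e a (bm_fun m);
  bm_ract : forall (X Y Z : C) (f : smor X Y) (g : smor Y Z) (h : smor X Z)
      (e : g ∘ f = h) (m : M _ _ f) (b : B _ _ g),
    bm_fun (ract e m b) = ract e (bm_fun m) b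
}.

Lemma bimapP (A B : galg) (M N : gbimod A B) (u v : bimap M N) :
  (forall (X Y : C) (f : smor X Y) m, @bm_fun _ _ _ _ u X Y f m = v X Y f m) ->
  u = v.
Proof.
case: u v => [u u1 u2 u3] [v v1 v2 v3] /= h.
have e : u = v.
  apply: functional_extensionality_dep => X.
  apply: functional_extensionality_dep => Y.
  by apply: functional_extensionality_dep => f; apply/funext => m.
by subst v; congr BiMap; exact: Prop_irrelevance.
Qed.

Definition bimId (A B : galg) (M : gbimod A B) : bimap M M.
Proof. by exists (fun X Y f m => m). Defined.

Definition bimComp (A B : galg) (M N P : gbimod A B) (v : bimap N P)
  (u : bimap M N) : bimap M P.
Proof.
exists (fun X Y f m => v X Y f (u X Y f m)).
- by move=> X Y f; apply: lin_comp; exact: bm_lin.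
- by move=> *; rewrite !bm_lact.
- by move=> *; rewrite !bm_ract.
Defined.

Definition bimCat (A B : galg) : category.
Proof.
by refine (@Category (gbimod A B) (@bimap A B) (@bimId A B) (@bimComp A B) _ _ _);
   move=> *; exact: bimapP.
Defined.

Definition regBim (A : galg) : gbimod A A :=
  GBimod (@gmul_bilin A) (@gmul_bilin A) (@gmulA A) (@gmulA A) (@gmulA A)
    (@gmul1l A) (@gmul1r A).

Lemma cocycle (X1 X2 X3 X4 X5 : C)
    (f1 : smor X1 X2) (f2 : smor X2 X3) (f3 : smor X3 X4) (f4 : smor X4 X5)
    f21 f32 f43 (e1 : f2 ∘ f1 = f21) (e2 : f3 ∘ f2 = f32) (e3 : f4 ∘ f3 = f43) :
  uval (galpha f1 f2 f3) * uval (galpha f1 f32 f4) * uval (galpha f2 f3 f4)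
  = uval (galpha f21 f3 f4) * uval (galpha f1 f2 f43).
Proof.
rewrite -e1 -e2 -e3; have := galpha_cocycle f1 f2 f3 f4.
have := uvalK (galpha f1 f2 (f4 ∘ f3)); have := uvalK (galpha (f2 ∘ f1) f3 f4).
move: (uval _) (uinv _) => a a' ha; move: (uval _) (uinv _) => b b' hb hc.
by rewrite -[RHS]mulr1 -hc; ring: ha hb.
Qed.
Arguments cocycle {X1 X2 X3 X4 X5} f1 f2 f3 f4 {f21 f32 f43} e1 e2 e3.

Lemma ucancel (u : kunit k) x y : uval u * x = uval u * y -> x = y.
Proof.
move=> /(congr1 (fun z => uinv u * z)).
by rewrite !mulrA [uinv u * _]mulrC uvalK !mul1r.
Qed.

Ltac ring_units :=
  lazymatch goal with
  | h1 : _ * _ = 1, h2 : _ * _ = 1, h3 : _ * _ = 1, h4 : _ * _ = 1 |- _ =>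
      ring: h1 h2 h3 h4
  | h1 : _ * _ = 1, h2 : _ * _ = 1, h3 : _ * _ = 1 |- _ => ring: h1 h2 h3
  | h1 : _ * _ = 1, h2 : _ * _ = 1 |- _ => ring: h1 h2
  | h1 : _ * _ = 1 |- _ => ring: h1
  | |- _ => ring
  end.

(* Closes an equation between products of units equivalent to [hc]. *)
Ltac scal hc :=
  repeat (match goal with |- context [uinv ?u] =>
    apply: (@ucancel u); let h := fresh "hu" in
    have h := uvalK u; move: (uinv u) h => ? h end);
  lazymatch type of hc with ?l = ?r =>
    first [ transitivity l; [ring_units | transitivity r; [exact hc | ring_units]]
          | transitivity r;
            [ring_units | transitivity l; [exact (esym hc) | ring_units]] ] end.

Section ActionLinearity.
Variables (A B : galg) (M : gbimod A B).
Variables (X Y Z : C) (f : smor X Y) (g : smor Y Z) (h : smor X Z).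
Hypothesis e : g ∘ f = h.

Lemma lact_linl (m : M _ _ g) : linear (fun a : A _ _ f => lact e a m).
Proof. exact: (lact_bilin M e).1. Qed.
Lemma lact_linr (a : A _ _ f) : linear (fun m : M _ _ g => lact e a m).
Proof. exact: (lact_bilin M e).2. Qed.
Lemma ract_linl (b : B _ _ g) : linear (fun m : M _ _ f => ract e m b).
Proof. exact: (ract_bilin M e).1. Qed.
Lemma ract_linr (m : M _ _ f) : linear (fun b : B _ _ g => ract e m b).
Proof. exact: (ract_bilin M e).2. Qed.
Lemma lactZr c (a : A _ _ f) (m : M _ _ g) : lact e a (c *: m) = c *: lact e a m.
Proof. exact: (linZ (lact_linr a)). Qed.
Lemma ractZl c (m : M _ _ f) (b : B _ _ g) : ract e (c *: m) b = c *: ract e m b.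
Proof. exact: (linZ (ract_linl b)). Qed.
Lemma lactZl c (a : A _ _ f) (m : M _ _ g) : lact e (c *: a) m = c *: lact e a m.
Proof. exact: (linZ (lact_linl m)). Qed.
Lemma ractZr c (m : M _ _ f) (b : B _ _ g) : ract e m (c *: b) = c *: ract e m b.
Proof. exact: (linZ (ract_linr m)). Qed.
End ActionLinearity.

(** [M ⊙ N] in degree [h]: the direct sum of the [M_f ⊗ N_g] over all
    factorizations [g ∘ f = h], modulo the balancing relations. *)
Section Tensor.
Variables (A B D : galg) (M : gbimod A B) (N : gbimod B D).

Record tgen (X Z : C) (h : smor X Z) := TGen {
  tg_mid : C;
  tg_f : smor X tg_mid;
  tg_g : smor tg_mid Z;
  tg_e : tg_g ∘ tg_f = h;
  tg_x : M _ _ tg_f;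
  tg_y : N _ _ tg_g
}.

Inductive trel (X Z : C) (h : smor X Z) :
    lterm k (tgen h) -> lterm k (tgen h) -> Prop :=
| trel_linl Y (f : smor X Y) (g : smor Y Z) (e : g ∘ f = h) c x x' y :
    trel (LGen k (TGen e (c *: x + x') y))
         (LAdd (LScale c (LGen k (TGen e x y))) (LGen k (TGen e x' y)))
| trel_linr Y (f : smor X Y) (g : smor Y Z) (e : g ∘ f = h) x c y y' :
    trel (LGen k (TGen e x (c *: y + y')))
         (LAdd (LScale c (LGen k (TGen e x y))) (LGen k (TGen e x y')))
| trel_bal Y Y' (f : smor X Y) (s : smor Y Y') (g : smor Y' Z) sf gs
    (e1 : s ∘ f = sf) (e2 : g ∘ sf = h) (e3 : g ∘ s = gs) (e4 : gs ∘ f = h)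
    (m : M _ _ f) (b : B _ _ s) (n : N _ _ g) :
    trel (LGen k (TGen e2 (ract e1 m b) n))
         (LScale (uval (galpha f s g)) (LGen k (TGen e4 m (lact e3 b n)))).

Definition tmod (X Z : C) (h : smor X Z) : lmodType k := pres (@trel X Z h).
Definition tns (X Y Z : C) (f : smor X Y) (g : smor Y Z) (h : smor X Z)
  (e : g ∘ f = h) (x : M _ _ f) (y : N _ _ g) : tmod h :=
  pgen (@trel X Z h) (TGen e x y).

Lemma tns_irr (X Y Z : C) (f : smor X Y) (g : smor Y Z) (h : smor X Z)
    (e e' : g ∘ f = h) x y : tns e x y = tns e' x y.
Proof. by rewrite (Prop_irrelevance e e'). Qed.

Lemma tns_linl (X Y Z : C) (f : smor X Y) (g : smor Y Z) (h : smor X Z)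
    (e : g ∘ f = h) y : linear (fun x => tns e x y).
Proof. by move=> c x x'; exact: (pres_rel (trel_linl e c x x' y)). Qed.

Lemma tns_linr (X Y Z : C) (f : smor X Y) (g : smor Y Z) (h : smor X Z)
    (e : g ∘ f = h) x : linear (tns e x).
Proof. by move=> c y y'; exact: (pres_rel (trel_linr e x c y y')). Qed.

Lemma tns_Zl (X Y Z : C) (f : smor X Y) (g : smor Y Z) (h : smor X Z)
    (e : g ∘ f = h) c x y : tns e (c *: x) y = c *: tns e x y.
Proof. exact: (linZ (tns_linl e y)). Qed.

Lemma tns_Zr (X Y Z : C) (f : smor X Y) (g : smor Y Z) (h : smor X Z)
    (e : g ∘ f = h) c x y : tns e x (c *: y) = c *: tns e x y.
Proof. exact: (linZ (tns_linr e x)). Qed.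

Lemma tns_bal (X Y Y' Z : C) (f : smor X Y) (s : smor Y Y') (g : smor Y' Z) h sf gs
    (e1 : s ∘ f = sf) (e2 : g ∘ sf = h) (e3 : g ∘ s = gs) (e4 : gs ∘ f = h) m b n :
  tns e2 (ract e1 m b) n = uval (galpha f s g) *: tns e4 m (lact e3 b n).
Proof. exact: (pres_rel (trel_bal e1 e2 e3 e4 m b n)). Qed.

Lemma tns_ext (X Z : C) (h : smor X Z) (V : lmodType k) (F G : tmod h -> V) :
  linear F -> linear G ->
  (forall Y (f : smor X Y) (g : smor Y Z) (e : g ∘ f = h) x y,
     F (tns e x y) = G (tns e x y)) -> F =1 G.
Proof. by move=> hF hG H; apply: pres_ext => // -[Y f g e x y]; exact: H. Qed.

Lemma tns_compat (X Z : C) (h : smor X Z) (V : lmodType k) (F : tgen h -> V) :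
  (forall Y (f : smor X Y) (g : smor Y Z) (e : g ∘ f = h) y,
     linear (fun x => F (TGen e x y))) ->
  (forall Y (f : smor X Y) (g : smor Y Z) (e : g ∘ f = h) x,
     linear (fun y => F (TGen e x y))) ->
  (forall Y Y' (f : smor X Y) (s : smor Y Y') (g : smor Y' Z) sf gs
    (e1 : s ∘ f = sf) (e2 : g ∘ sf = h) (e3 : g ∘ s = gs) (e4 : gs ∘ f = h) m b n,
    F (TGen e2 (ract e1 m b) n)
    = uval (galpha f s g) *: F (TGen e4 m (lact e3 b n))) ->
  compat (@trel X Z h) F.
Proof.
move=> h1 h2 h3 x y [] *; rewrite /=; [exact: h1|exact: h2|exact: h3].
Qed.

Lemma factor_l (X Y W Z : C) (f : smor X Y) (g1 : smor Y W) (g2 : smor W Z) g h :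
  g ∘ f = h -> g2 ∘ g1 = g -> g2 ∘ (g1 ∘ f) = h.
Proof. by move=> <- <-; rewrite scompA. Qed.

Lemma factor_r (X Y W Z : C) (f1 : smor X Y) (f2 : smor Y W) (g : smor W Z) f h :
  g ∘ f = h -> f2 ∘ f1 = f -> (g ∘ f2) ∘ f1 = h.
Proof. by move=> <- <-; rewrite scompA. Qed.

Definition lactT_gen (X Y Z : C) (f : smor X Y) (g : smor Y Z) (h : smor X Z)
  (e : g ∘ f = h) (a : A _ _ f) (t : tgen g) : tmod h :=
  uinv (galpha f (tg_f t) (tg_g t))
  *: tns (factor_l e (tg_e t)) (lact erefl a (tg_x t)) (tg_y t).

Definition ractT_gen (X Y Z : C) (f : smor X Y) (g : smor Y Z) (h : smor X Z)
  (e : g ∘ f = h) (d : D _ _ g) (t : tgen f) : tmod h :=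
  uval (galpha (tg_f t) (tg_g t) g)
  *: tns (factor_r e (tg_e t)) (tg_x t) (ract erefl (tg_y t) d).

Lemma lactT_compat (X Y Z : C) (f : smor X Y) (g : smor Y Z) (h : smor X Z)
  (e : g ∘ f = h) (a : A _ _ f) : compat (@trel Y Z g) (lactT_gen e a).
Proof.
apply: tns_compat => [W p q e' y|W p q e' x|W W' p s q sp qs e1 e2 e3 e4 m b n];
  rewrite /lactT_gen /=.
- apply: lin_scale; apply: (lin_comp (tns_linl _ _)); exact: lact_linr.
- by apply: lin_scale; exact: tns_linr.
have e5 : s ∘ (p ∘ f) = sp ∘ f by rewrite -e1 scompA.
have := lractA (erefl (p ∘ f)) e5 e1 erefl a m b.
move=> /(congr1 (fun z => uinv (galpha f p s) *: z)).
rewrite [RHS]scalerA [X in _ = X *: _]mulrC uvalK scale1r => <-.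
rewrite tns_Zl; have e6 : qs ∘ (p ∘ f) = h by rewrite -e -e4 scompA.
rewrite (tns_bal e5 _ e3 e6) (tns_irr e6 (factor_l e e4)) !scalerA; congr (_ *: _).
have hc := cocycle f p s q erefl e1 e3.
scal hc.
Qed.

Lemma ractT_compat (X Y Z : C) (f : smor X Y) (g : smor Y Z) (h : smor X Z)
  (e : g ∘ f = h) (d : D _ _ g) : compat (@trel X Y f) (ractT_gen e d).
Proof.
apply: tns_compat => [W p q e' y|W p q e' x|W W' p s q sp qs e1 e2 e3 e4 m b n];
  rewrite /ractT_gen /=.
- by apply: lin_scale; exact: tns_linl.
- apply: lin_scale; apply: (lin_comp (tns_linr _ _)); exact: ract_linl.
have e5 : (g ∘ q) ∘ s = g ∘ qs by rewrite -e3 scompA.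
have e6 : (g ∘ qs) ∘ p = h by rewrite -e -e4 scompA.
rewrite (tns_bal e1 _ e5 e6) (tns_irr (factor_r e e4) e6).
rewrite (lractA e3 (erefl (g ∘ qs)) erefl e5) tns_Zr !scalerA; congr (_ *: _).
have hc := cocycle p s q g e1 e3 erefl.
scal hc.
Qed.

Definition lactT : gbilin A (GMod tmod) (GMod tmod) :=
  fun X Y Z f g h e a => plift (lactT_compat e a).
Definition ractT : gbilin (GMod tmod) D (GMod tmod) :=
  fun X Y Z f g h e t d => plift (ractT_compat e d) t.

Lemma lactT_tns (X Y W Z : C) (f : smor X Y) (g : smor Y Z) (h : smor X Z)
    (g1 : smor Y W) (g2 : smor W Z) gf (e : g ∘ f = h) (e1 : g2 ∘ g1 = g)
    (e2 : g1 ∘ f = gf) (e3 : g2 ∘ gf = h) a x y :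
  lactT e a (tns e1 x y) = uinv (galpha f g1 g2) *: tns e3 (lact e2 a x) y.
Proof.
by case: _ / e2 e3 => e3; rewrite /lactT plift_gen /lactT_gen /= (tns_irr _ e3).
Qed.

Lemma ractT_tns (X Y W Z : C) (f : smor X Y) (g : smor Y Z) (h : smor X Z)
    (f1 : smor X W) (f2 : smor W Y) gf (e : g ∘ f = h) (e1 : f2 ∘ f1 = f)
    (e2 : g ∘ f2 = gf) (e3 : gf ∘ f1 = h) x y d :
  ractT e (tns e1 x y) d = uval (galpha f1 f2 g) *: tns e3 x (ract e2 y d).
Proof.
by case: _ / e2 e3 => e3; rewrite /ractT plift_gen /ractT_gen /= (tns_irr _ e3).
Qed.

Lemma lactT_bilin : is_gbilin lactT.
Proof.
move=> X Y Z f g h e; split=> [t|a]; last exact: (plift_linear (lactT_compat e a)).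
apply: plift_lin2 => -[W p q e' x y]; rewrite /lactT_gen /=.
apply: lin_scale; apply: (lin_comp (tns_linl _ _)); exact: lact_linl.
Qed.

Lemma ractT_bilin : is_gbilin ractT.
Proof.
move=> X Y Z f g h e; split=> [d|t]; first exact: (plift_linear (ractT_compat e d)).
apply: plift_lin2 => -[W p q e' x y]; rewrite /ractT_gen /=.
apply: lin_scale; apply: (lin_comp (tns_linr _ _)); exact: ract_linr.
Qed.

Lemma lactT_lin X Y Z (f : smor X Y) (g : smor Y Z) h (e : g ∘ f = h) a :
  linear (lactT e a).
Proof. exact: (lactT_bilin e).2. Qed.

Lemma ractT_lin X Y Z (f : smor X Y) (g : smor Y Z) h (e : g ∘ f = h) d :
  linear (fun t => ractT e t d).
Proof. exact: (ractT_bilin e).1. Qed.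

Lemma lactTA : gassoc (@gmul A) lactT lactT lactT.
Proof.
move=> X Y Z W f g h gf hg q e1 e2 e3 e4 a a'.
apply: tns_ext => [||V p r e5 x y].
- exact: lactT_lin.
- apply: lin_scale; apply: (lin_comp (lactT_lin _ _)); exact: lactT_lin.
have e6 : r ∘ (p ∘ gf) = q by rewrite -e2 -e5 !scompA.
have e7 : r ∘ (p ∘ g) = hg by rewrite -e3 -e5 !scompA.
have e8 : (p ∘ g) ∘ f = p ∘ gf by rewrite -e1 scompA.
rewrite (lactT_tns _ _ erefl e6) (lactT_tns _ _ erefl e7).
rewrite (linZ (lactT_lin _ _)) (lactT_tns _ _ e8 e6) (lactA e1 erefl erefl e8).
rewrite tns_Zl !scalerA; congr (_ *: _).
have hc := cocycle f g p r e1 erefl e5.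
scal hc.
Qed.

Lemma ractTA : gassoc ractT ractT ractT (@gmul D).
Proof.
move=> X Y Z W f g h gf hg q e1 e2 e3 e4 t d d'; move: t.
apply: tns_ext => [||V p r e5 x y].
- apply: (lin_comp (ractT_lin _ _)); exact: ractT_lin.
- by apply: lin_scale; exact: ractT_lin.
have e6 : (g ∘ r) ∘ p = gf by rewrite -e1 -e5 !scompA.
have e7 : (hg ∘ r) ∘ p = q by rewrite -e4 -e5 !scompA.
have e8 : h ∘ (g ∘ r) = hg ∘ r by rewrite -e3 scompA.
rewrite (ractT_tns _ _ erefl e6) (ractT_tns _ _ erefl e7).
rewrite (linZ (ractT_lin _ _)) (ractT_tns _ _ e8 e7) (ractA erefl e8 e3 erefl).
rewrite tns_Zr !scalerA; congr (_ *: _).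
have hc := cocycle p r g h e5 erefl e3.
scal hc.
Qed.

Lemma lractTA : gassoc lactT ractT lactT ractT.
Proof.
move=> X Y Z W f g h gf hg q e1 e2 e3 e4 a t d; move: t.
apply: tns_ext => [||V p r e5 x y].
- apply: (lin_comp (ractT_lin _ _)); exact: lactT_lin.
- apply: lin_scale; apply: (lin_comp (lactT_lin _ _)); exact: ractT_lin.
have e6 : r ∘ (p ∘ f) = gf by rewrite -e1 -e5 !scompA.
have e7 : (h ∘ r) ∘ (p ∘ f) = q by rewrite -e2 -e6 !scompA.
have e8 : (h ∘ r) ∘ p = hg by rewrite -e3 -e5 !scompA.
rewrite (lactT_tns _ _ erefl e6) (ractT_tns _ _ erefl e8).
rewrite (linZ (ractT_lin _ _)) (linZ (lactT_lin _ _)).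
rewrite (ractT_tns _ _ erefl e7) (lactT_tns _ _ erefl e7) !scalerA; congr (_ *: _).
have hc := cocycle f p r h erefl e5 erefl.
scal hc.
Qed.

Lemma lactT1 (X Y : C) (f : smor X Y) (e : f ∘ sid X = f) (t : tmod f) :
  lactT e (gone A X) t = Lc f *: t.
Proof.
move: t; apply: tns_ext => [||V p r e5 x y].
- exact: lactT_lin.
- exact/lin_scale/lin_id.
rewrite (lactT_tns _ _ (scompfI p) e5) lact1 tns_Zl !scalerA; congr (_ *: _).
have hc := cocycle (sid X) (sid X) p r (scompIf _) (scompfI _) e5.
have {}hc : uval (galpha (sid X) (sid X) p) * uval (galpha (sid X) p r)
    = uval (galpha (sid X) (sid X) f).
  by apply: (@ucancel (galpha (sid X) p r)); rewrite -hc mulrC.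
rewrite /Lc; scal hc.
Qed.

Lemma ractT1 (X Y : C) (f : smor X Y) (e : sid Y ∘ f = f) (t : tmod f) :
  ractT e t (gone D Y) = Rc f *: t.
Proof.
move: t; apply: tns_ext => [||V p r e5 x y].
- exact: ractT_lin.
- exact/lin_scale/lin_id.
rewrite (ractT_tns _ _ (scompIf r) e5) ract1 tns_Zr !scalerA; congr (_ *: _).
have hc := cocycle p r (sid Y) (sid Y) e5 (scompIf _) (scompIf _).
rewrite /Rc.
have {}hc : uval (galpha p r (sid Y)) * uval (galpha r (sid Y) (sid Y))
    = uval (galpha f (sid Y) (sid Y)).
  apply: (@ucancel (galpha p r (sid Y))).
  by rewrite mulrA hc mulrC.
scal hc.
Qed.

Definition tensBim : gbimod A D :=
  GBimod lactT_bilin ractT_bilin lactTA ractTA lractTA lactT1 ractT1.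

End Tensor.

Section TensorMap.
Variables (A B D : galg) (M M' : gbimod A B) (N N' : gbimod B D).
Variables (u : bimap M M') (v : bimap N N').

Lemma tensMap_compat (X Z : C) (h : smor X Z) :
  compat (@trel _ _ _ M N X Z h)
    (fun t => tns (tg_e t) (u _ _ _ (tg_x t)) (v _ _ _ (tg_y t))).
Proof.
apply: tns_compat => [W p q e' y|W p q e' x|W W' p s q sp qs e1 e2 e3 e4 m b n] /=.
- apply: (lin_comp (tns_linl _ _)); exact: bm_lin.
- apply: (lin_comp (tns_linr _ _)); exact: bm_lin.
by rewrite bm_ract bm_lact (tns_bal e1 e2 e3 e4).
Qed.

Definition tensMap_fun (X Z : C) (h : smor X Z) : tmod M N h -> tmod M' N' h :=
  plift (@tensMap_compat X Z h).

Lemma tensMap_lin (X Z : C) (h : smor X Z) : linear (@tensMap_fun X Z h).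
Proof. exact: plift_linear. Qed.

Lemma tensMap_tns (X Y Z : C) (f : smor X Y) (g : smor Y Z) (h : smor X Z)
    (e : g ∘ f = h) x y :
  tensMap_fun (tns e x y) = tns e (u _ _ _ x) (v _ _ _ y).
Proof. exact: plift_gen. Qed.

Definition tensMap : bimap (tensBim M N) (tensBim M' N').
Proof.
exists tensMap_fun; first exact: tensMap_lin.
- move=> X Y Z f g h e a; apply: tns_ext => [||V p r e5 x y].
  + apply: (lin_comp (@tensMap_lin _ _ _)); exact: lactT_lin.
  + apply: (lin_comp (lactT_lin _ _)); exact: tensMap_lin.
  have e6 := factor_l e e5.
  rewrite /= (lactT_tns _ _ erefl e6) (linZ (@tensMap_lin _ _ _)) !tensMap_tns.
  by rewrite (lactT_tns _ _ erefl e6) bm_lact.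
- move=> X Y Z f g h e t d; move: t; apply: tns_ext => [||V p r e5 x y].
  + apply: (lin_comp (@tensMap_lin _ _ _)); exact: ractT_lin.
  + apply: (lin_comp (ractT_lin _ _)); exact: tensMap_lin.
  have e6 := factor_r e e5.
  rewrite /= (ractT_tns _ _ erefl e6) (linZ (@tensMap_lin _ _ _)) !tensMap_tns.
  by rewrite (ractT_tns _ _ erefl e6) bm_ract.
Defined.

End TensorMap.

Definition tensFun (A B D : galg) :
  functor (prodcat (bimCat A B) (bimCat B D)) (bimCat A D).
Proof.
refine (@Functor (prodcat (bimCat A B) (bimCat B D)) (bimCat A D)
  (fun p => tensBim p.1 p.2) (fun p q u => tensMap u.1 u.2) _ _).
- move=> [M N]; apply: bimapP => X Z h; apply: tns_ext => [||Y f g e x y] //=.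
  + exact: tensMap_lin.
  + by rewrite tensMap_tns.
- move=> [M N] [M' N'] [M'' N''] [u u'] [v v']; apply: bimapP => X Z h.
  apply: tns_ext => [||Y f g e x y] /=.
  + exact: tensMap_lin.
  + apply: (lin_comp (@tensMap_lin _ _ _ _ _ _ _ _ _ _ _ _)).
    exact: tensMap_lin.
  + by rewrite !tensMap_tns.
Defined.

Section BimIso.
Variables (A B : galg) (M N : gbimod A B) (u : bimap M N).
Variable w : forall (X Y : C) (f : smor X Y), N _ _ f -> M _ _ f.
Hypothesis uK : forall (X Y : C) (f : smor X Y) m, w (u X Y f m) = m.
Hypothesis wK : forall (X Y : C) (f : smor X Y) n, u X Y f (w n) = n.

Definition bimInv : bimap N M.
Proof.
exists w.
- by move=> X Y f c x y; rewrite -{1}(wK x) -{1}(wK y) -bm_lin uK.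
- by move=> X Y Z f g h e a m; rewrite -{1}(wK m) -bm_lact uK.
- by move=> X Y Z f g h e m b; rewrite -{1}(wK m) -bm_ract uK.
Defined.

Definition bimIso : @iso (bimCat A B) M N.
Proof.
by exists u bimInv; apply: bimapP => X Y f m /=; [exact: uK|exact: wK].
Defined.

End BimIso.

Section Unitors.
Variables (A B : galg) (M : gbimod A B).

Lemma lunit_compat (X Z : C) (h : smor X Z) :
  compat (@trel _ _ _ (regBim A) M X Z h)
    (fun t => lact (tg_e t) (tg_x t) (tg_y t)).
Proof.
apply: tns_compat => [W p q e' y|W p q e' x|W W' p s q sp qs e1 e2 e3 e4 m b n] /=.
- exact: lact_linl.
- exact: lact_linr.
- exact: lactA.
Qed.

Definition lunit_fun (X Z : C) (h : smor X Z) : tmod (regBim A) M h -> M _ _ h :=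
  plift (@lunit_compat X Z h).

Lemma lunit_lin (X Z : C) (h : smor X Z) : linear (@lunit_fun X Z h).
Proof. exact: plift_linear. Qed.

Lemma lunit_tns (X Y Z : C) (f : smor X Y) (g : smor Y Z) (h : smor X Z)
    (e : g ∘ f = h) a m :
  lunit_fun (tns (M := regBim A) e a m) = lact e a m.
Proof. exact: plift_gen. Qed.

Definition lunit_map : bimap (tensBim (regBim A) M) M.
Proof.
exists lunit_fun; first exact: lunit_lin.
- move=> X Y Z f g h e a; apply: tns_ext => [||V p r e5 x y] /=.
  + apply: (lin_comp (@lunit_lin _ _ _)); exact: lactT_lin.
  + apply: (lin_comp (@lact_linr _ _ _ _ _ _ _ _ _ e a)); exact: lunit_lin.
  have e6 := factor_l e e5.
  rewrite (lactT_tns _ _ erefl e6) (linZ (@lunit_lin _ _ _)) !lunit_tns.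
  by rewrite /= (lactA erefl e6 e5 e) scalerA mulrC uvalK scale1r.
- move=> X Y Z f g h e t d; move: t; apply: tns_ext => [||V p r e5 x y] /=.
  + apply: (lin_comp (@lunit_lin _ _ _)); exact: ractT_lin.
  + apply: (lin_comp (@ract_linl _ _ _ _ _ _ _ _ _ e d)); exact: lunit_lin.
  have e6 := factor_r e e5.
  rewrite (ractT_tns _ _ erefl e6) (linZ (@lunit_lin _ _ _)) !lunit_tns.
  by rewrite (lractA e5 e erefl e6).
Defined.

Definition lunit_inv (X Y : C) (f : smor X Y) (m : M _ _ f) : tmod (regBim A) M f :=
  uval (galpha (sid X) (sid X) f)
  *: tns (M := regBim A) (scompfI f) (gone A X) m.

Lemma lunitK (X Y : C) (f : smor X Y) t : lunit_inv (lunit_map X Y f t) = t.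
Proof.
move: t; apply: tns_ext => [||V p r e x y] /=.
- apply: lin_scale; apply: (lin_comp (tns_linr _ _)); exact: lunit_lin.
- exact: lin_id.
rewrite lunit_tns /lunit_inv.
have := tns_bal (M := regBim A) (N := M) (scompfI p) e e (scompfI f) (gone A X) x y.
rewrite /= gmul1l (tns_Zl (M := regBim A)) => /(congr1 (fun z =>
  (uval (galpha (sid X) (sid X) f) * uinv (galpha (sid X) p r)) *: z)).
rewrite !scalerA -[X in _ = X *: _]mulrA [uinv _ * uval _]mulrC uvalK mulr1 => <-.
rewrite -[RHS]scale1r; congr (_ *: _).
have hc := cocycle (sid X) (sid X) p r (scompIf _) (scompfI _) e.
have {}hc : uval (galpha (sid X) (sid X) p) * uval (galpha (sid X) p r)
    = uval (galpha (sid X) (sid X) f).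
  by apply: (@ucancel (galpha (sid X) p r)); rewrite -hc mulrC.
rewrite /Lc; scal hc.
Qed.

Lemma lunitVK (X Y : C) (f : smor X Y) m : lunit_map X Y f (lunit_inv m) = m.
Proof.
rewrite /= /lunit_inv (linZ (@lunit_lin _ _ _)) lunit_tns lact1 scalerA uvalK.
exact: scale1r.
Qed.

Definition lunitor : @iso (bimCat A B) (tensBim (regBim A) M) M :=
  bimIso lunitK lunitVK.

Lemma runit_compat (X Z : C) (h : smor X Z) :
  compat (@trel _ _ _ M (regBim B) X Z h)
    (fun t => ract (tg_e t) (tg_x t) (tg_y t)).
Proof.
apply: tns_compat => [W p q e' y|W p q e' x|W W' p s q sp qs e1 e2 e3 e4 m b n] /=.
- exact: ract_linl.
- exact: ract_linr.
- exact: ractA.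
Qed.

Definition runit_fun (X Z : C) (h : smor X Z) : tmod M (regBim B) h -> M _ _ h :=
  plift (@runit_compat X Z h).

Lemma runit_lin (X Z : C) (h : smor X Z) : linear (@runit_fun X Z h).
Proof. exact: plift_linear. Qed.

Lemma runit_tns (X Y Z : C) (f : smor X Y) (g : smor Y Z) (h : smor X Z)
    (e : g ∘ f = h) m b :
  runit_fun (tns (N := regBim B) e m b) = ract e m b.
Proof. exact: plift_gen. Qed.

Definition runit_map : bimap (tensBim M (regBim B)) M.
Proof.
exists runit_fun; first exact: runit_lin.
- move=> X Y Z f g h e a; apply: tns_ext => [||V p r e5 x y] /=.
  + apply: (lin_comp (@runit_lin _ _ _)); exact: lactT_lin.
  + apply: (lin_comp (@lact_linr _ _ _ _ _ _ _ _ _ e a)); exact: runit_lin.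
  have e6 := factor_l e e5.
  rewrite (lactT_tns _ _ erefl e6) (linZ (@runit_lin _ _ _)) !runit_tns.
  by rewrite /= (lractA erefl e6 e5 e) scalerA mulrC uvalK scale1r.
- move=> X Y Z f g h e t d; move: t; apply: tns_ext => [||V p r e5 x y] /=.
  + apply: (lin_comp (@runit_lin _ _ _)); exact: ractT_lin.
  + apply: (lin_comp (@ract_linl _ _ _ _ _ _ _ _ _ e d)); exact: runit_lin.
  have e6 := factor_r e e5.
  rewrite (ractT_tns _ _ erefl e6) (linZ (@runit_lin _ _ _)) !runit_tns.
  by rewrite (ractA e5 e erefl e6).
Defined.

Definition runit_inv (X Y : C) (f : smor X Y) (m : M _ _ f) : tmod M (regBim B) f :=
  uinv (galpha f (sid Y) (sid Y))
  *: tns (N := regBim B) (scompIf f) m (gone B Y).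

Lemma runitK (X Y : C) (f : smor X Y) t : runit_inv (runit_map X Y f t) = t.
Proof.
move: t; apply: tns_ext => [||V p r e x y] /=.
- apply: lin_scale; apply: (lin_comp (tns_linl _ _)); exact: runit_lin.
- exact: lin_id.
rewrite runit_tns /runit_inv.
rewrite (tns_bal (M := M) (N := regBim B) e (scompIf f) (scompIf r) e) /=.
rewrite gmul1r (tns_Zr (N := regBim B)) !scalerA -[RHS]scale1r; congr (_ *: _).
have hc := cocycle p r (sid Y) (sid Y) e (scompIf _) (scompIf _).
have {}hc : uval (galpha p r (sid Y)) * uval (galpha r (sid Y) (sid Y))
    = uval (galpha f (sid Y) (sid Y)).
  by apply: (@ucancel (galpha p r (sid Y))); rewrite mulrA hc mulrC.
rewrite /Rc; scal hc.
Qed.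

Lemma runitVK (X Y : C) (f : smor X Y) m : runit_map X Y f (runit_inv m) = m.
Proof.
rewrite /= /runit_inv (linZ (@runit_lin _ _ _)) runit_tns ract1 scalerA mulrC uvalK.
exact: scale1r.
Qed.

Definition runitor : @iso (bimCat A B) (tensBim M (regBim B)) M :=
  bimIso runitK runitVK.

End Unitors.

Section Assoc.
Variables (A B D E : galg) (M : gbimod A B) (N : gbimod B D) (P : gbimod D E).
Local Notation MN := (tensBim M N).
Local Notation NP := (tensBim N P).

Definition asc1_gen (X Y Z : C) (f : smor X Y) (g : smor Y Z) (h : smor X Z)
  (e : g ∘ f = h) (p : P _ _ g) (t : tgen M N f) : tmod M NP h :=
  uval (galpha (tg_f t) (tg_g t) g)
  *: tns (N := NP) (factor_r e (tg_e t)) (tg_x t) (tns erefl (tg_y t) p).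

Lemma asc1_compat (X Y Z : C) (f : smor X Y) (g : smor Y Z) (h : smor X Z)
  (e : g ∘ f = h) (p : P _ _ g) : compat (@trel _ _ _ M N X Y f) (asc1_gen e p).
Proof.
apply: tns_compat => [W a b e' y|W a b e' x|W W' a s b sa bs e1 e2 e3 e4 m c n];
  rewrite /asc1_gen /=.
- by apply: lin_scale; exact: tns_linl.
- apply: lin_scale; apply: (lin_comp (tns_linr _ _)); exact: tns_linl.
have e5 : (g ∘ b) ∘ s = g ∘ bs by rewrite -e3 scompA.
have e6 : (g ∘ bs) ∘ a = h by rewrite -e -e4 !scompA.
rewrite (tns_bal (N := NP) e1 _ e5 e6) (tns_irr (factor_r e e4) e6) /=.
rewrite (lactT_tns _ _ e3 erefl) (tns_Zr (N := NP)) !scalerA; congr (_ *: _).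
have hc := cocycle a s b g e1 e3 erefl.
scal hc.
Qed.

Definition asc1 (X Y Z : C) (f : smor X Y) (g : smor Y Z) (h : smor X Z)
  (e : g ∘ f = h) (t : MN _ _ f) (p : P _ _ g) : tmod M NP h :=
  plift (asc1_compat e p) t.

Lemma asc1_linl (X Y Z : C) (f : smor X Y) (g : smor Y Z) (h : smor X Z)
  (e : g ∘ f = h) p : linear (fun t => asc1 e t p).
Proof. exact: (plift_linear (asc1_compat e p)). Qed.

Lemma asc1_linr (X Y Z : C) (f : smor X Y) (g : smor Y Z) (h : smor X Z)
  (e : g ∘ f = h) t : linear (asc1 e t).
Proof.
apply: plift_lin2 => -[W p q e' x y]; rewrite /asc1_gen /=.
apply: lin_scale; apply: (lin_comp (tns_linr _ _)); exact: tns_linr.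
Qed.

Lemma asc1_tns (X W Y Z : C) (f1 : smor X W) (f2 : smor W Y) (f : smor X Y)
    (g : smor Y Z) (h : smor X Z) gf (e : g ∘ f = h) (e1 : f2 ∘ f1 = f)
    (e2 : g ∘ f2 = gf) (e3 : gf ∘ f1 = h) m n p :
  asc1 e (tns e1 m n) p
  = uval (galpha f1 f2 g) *: tns (N := NP) e3 m (tns e2 n p).
Proof.
by case: _ / e2 e3 => e3; rewrite /asc1 plift_gen /asc1_gen /= (tns_irr _ e3).
Qed.

Lemma asc_compat (X Z : C) (h : smor X Z) :
  compat (@trel _ _ _ MN P X Z h) (fun t => asc1 (tg_e t) (tg_x t) (tg_y t)).
Proof.
apply: tns_compat => [W a b e' y|W a b e' x|W W' a s b sa bs e1 e2 e3 e4 t d n] /=.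
- exact: asc1_linl.
- exact: asc1_linr.
move: t; apply: tns_ext => [||V p r e5 x y].
- apply: (lin_comp (@asc1_linl _ _ _ _ _ _ e2 n)); exact: ractT_lin.
- apply: lin_scale; exact: asc1_linl.
have e6 := factor_r e1 e5; have e7 := factor_r e4 e5.
have e8 : b ∘ (s ∘ r) = bs ∘ r by rewrite -e3 scompA.
rewrite (ractT_tns _ _ erefl e6) (linZ (@asc1_linl _ _ _ _ _ _ e2 n)).
rewrite (asc1_tns _ _ e8 e7) (asc1_tns _ _ erefl e7).
rewrite (tns_bal erefl e8 e3 erefl) (tns_Zr (N := NP)) !scalerA; congr (_ *: _).
have hc := cocycle p r s b e5 erefl e3.
scal hc.
Qed.

Definition asc_fun (X Z : C) (h : smor X Z) : tmod MN P h -> tmod M NP h :=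
  plift (@asc_compat X Z h).

Lemma asc_lin (X Z : C) (h : smor X Z) : linear (@asc_fun X Z h).
Proof. exact: plift_linear. Qed.

Lemma asc_tns (X W Y Z : C) (f1 : smor X W) (f2 : smor W Y) (f : smor X Y)
    (g : smor Y Z) (h : smor X Z) gf (e : g ∘ f = h) (e1 : f2 ∘ f1 = f)
    (e2 : g ∘ f2 = gf) (e3 : gf ∘ f1 = h) m n p :
  asc_fun (tns (M := MN) e (tns e1 m n) p)
  = uval (galpha f1 f2 g) *: tns (N := NP) e3 m (tns e2 n p).
Proof. by rewrite /asc_fun plift_gen /=; exact: asc1_tns. Qed.

Lemma tns_ext_l (X Z : C) (h : smor X Z) (V : lmodType k)
    (F G : tmod MN P h -> V) :
  linear F -> linear G ->
  (forall W Y (f1 : smor X W) (f2 : smor W Y) (f : smor X Y) (g : smor Y Z)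
      (e : g ∘ f = h) (e1 : f2 ∘ f1 = f) m n p,
     F (tns (M := MN) e (tns e1 m n) p) = G (tns (M := MN) e (tns e1 m n) p)) ->
  F =1 G.
Proof.
move=> hF hG H; apply: tns_ext => // Y f g e t p; move: t.
apply: tns_ext => [||W f1 f2 e1 m n]; last exact: H.
- exact: (lin_comp hF (@tns_linl _ _ _ MN P _ _ _ _ _ _ e p)).
- exact: (lin_comp hG (@tns_linl _ _ _ MN P _ _ _ _ _ _ e p)).
Qed.

Lemma tns_ext_r (X Z : C) (h : smor X Z) (V : lmodType k)
    (F G : tmod M NP h -> V) :
  linear F -> linear G ->
  (forall Y W (f : smor X Y) (g1 : smor Y W) (g2 : smor W Z) (g : smor Y Z)
      (e : g ∘ f = h) (e1 : g2 ∘ g1 = g) m n p,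
     F (tns (N := NP) e m (tns e1 n p)) = G (tns (N := NP) e m (tns e1 n p))) ->
  F =1 G.
Proof.
move=> hF hG H; apply: tns_ext => // Y f g e m.
apply: tns_ext => [||W f1 f2 e1 n p]; last exact: H.
- exact: (lin_comp hF (@tns_linr _ _ _ M NP _ _ _ _ _ _ e m)).
- exact: (lin_comp hG (@tns_linr _ _ _ M NP _ _ _ _ _ _ e m)).
Qed.

Definition asc_map : bimap (tensBim MN P) (tensBim M NP).
Proof.
exists asc_fun; first exact: asc_lin.
- move=> X Y Z f g h e a /=; apply: tns_ext_l => [||V W p q pq r e5 e6 m n l].
  + apply: (lin_comp (@asc_lin _ _ _)); exact: (lactT_lin (M := MN)).
  + apply: (lin_comp (lactT_lin (N := NP) _ _)); exact: asc_lin.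
  have e7 : q ∘ (p ∘ f) = pq ∘ f by rewrite -e6 scompA.
  have e8 : r ∘ (pq ∘ f) = h by rewrite -e -e5 !scompA.
  have e9 : (r ∘ q) ∘ p = g by rewrite -e5 -e6 !scompA.
  have e10 : (r ∘ q) ∘ (p ∘ f) = h by rewrite -e -e9 !scompA.
  rewrite (lactT_tns (M := MN) _ _ erefl e8) /= (lactT_tns _ _ erefl e7).
  rewrite (tns_Zl (M := MN)) scalerA (linZ (@asc_lin _ _ _)).
  rewrite (asc_tns _ _ erefl e10) (asc_tns _ _ erefl e9).
  rewrite (linZ (lactT_lin (N := NP) _ _)) (lactT_tns (N := NP) _ _ erefl e10).
  rewrite !scalerA; congr (_ *: _).
  have hc := cocycle f p q r erefl e6 erefl.
  scal hc.
- move=> X Y Z f g h e t d; move: t => /=.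
  apply: tns_ext_l => [||V W p q pq r e5 e6 m n l].
  + apply: (lin_comp (@asc_lin _ _ _)); exact: (ractT_lin (M := MN)).
  + apply: (lin_comp (ractT_lin (N := NP) _ _)); exact: asc_lin.
  have e7 : (g ∘ r) ∘ pq = h by rewrite -e -e5 !scompA.
  have e8 : (r ∘ q) ∘ p = f by rewrite -e5 -e6 !scompA.
  have e9 : (g ∘ r) ∘ q = g ∘ (r ∘ q) by rewrite scompA.
  have e10 : (g ∘ (r ∘ q)) ∘ p = h by rewrite -e -e8 !scompA.
  rewrite (ractT_tns (M := MN) _ _ erefl e7) (linZ (@asc_lin _ _ _)).
  rewrite (asc_tns _ _ e9 e10) (asc_tns _ _ erefl e8).
  rewrite (linZ (ractT_lin (N := NP) _ _)) (ractT_tns (N := NP) _ _ erefl e10) /=.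
  rewrite (ractT_tns _ _ erefl e9) (tns_Zr (N := NP)).
  rewrite !scalerA; congr (_ *: _).
  have hc := cocycle p q r g e6 erefl erefl.
  scal hc.
Defined.

Definition asci1_gen (X Y Z : C) (f : smor X Y) (g : smor Y Z) (h : smor X Z)
  (e : g ∘ f = h) (m : M _ _ f) (t : tgen N P g) : tmod MN P h :=
  uinv (galpha f (tg_f t) (tg_g t))
  *: tns (M := MN) (factor_l e (tg_e t)) (tns erefl m (tg_x t)) (tg_y t).

Lemma asci1_compat (X Y Z : C) (f : smor X Y) (g : smor Y Z) (h : smor X Z)
  (e : g ∘ f = h) (m : M _ _ f) : compat (@trel _ _ _ N P Y Z g) (asci1_gen e m).
Proof.
apply: tns_compat => [W a b e' y|W a b e' x|W W' a s b sa bs e1 e2 e3 e4 n c p];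
  rewrite /asci1_gen /=.
- apply: lin_scale; apply: (lin_comp (tns_linl _ _)); exact: tns_linr.
- by apply: lin_scale; exact: tns_linr.
have e5 : s ∘ (a ∘ f) = sa ∘ f by rewrite -e1 scompA.
have e6 : bs ∘ (a ∘ f) = h by rewrite -e -e4 !scompA.
have := tns_bal (M := MN) (N := P) e5 (factor_l e e2) e3 e6 (tns erefl m n) c p.
rewrite /= (ractT_tns _ _ e1 erefl) (tns_Zl (M := MN)).
move=> /(congr1 (fun z => uinv (galpha f a s) *: z)).
rewrite [LHS]scalerA [X in X *: _ = _ -> _]mulrC uvalK scale1r => ->.
rewrite (tns_irr (factor_l e e4) e6) !scalerA -!mulrA; congr (_ *: _).
have hc := cocycle f a s b erefl e1 e3.
scal hc.
Qed.

Definition asci1 (X Y Z : C) (f : smor X Y) (g : smor Y Z) (h : smor X Z)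
  (e : g ∘ f = h) (m : M _ _ f) (t : NP _ _ g) : tmod MN P h :=
  plift (asci1_compat e m) t.

Lemma asci1_linr (X Y Z : C) (f : smor X Y) (g : smor Y Z) (h : smor X Z)
  (e : g ∘ f = h) m : linear (asci1 e m).
Proof. exact: (plift_linear (asci1_compat e m)). Qed.

Lemma asci1_linl (X Y Z : C) (f : smor X Y) (g : smor Y Z) (h : smor X Z)
  (e : g ∘ f = h) t : linear (fun m => asci1 e m t).
Proof.
apply: plift_lin2 => -[W p q e' x y]; rewrite /asci1_gen /=.
apply: lin_scale; apply: (lin_comp (tns_linl _ _)); exact: tns_linl.
Qed.

Lemma asci1_tns (X Y W Z : C) (f : smor X Y) (g1 : smor Y W) (g2 : smor W Z)
    (g : smor Y Z) (h : smor X Z) gf (e : g ∘ f = h) (e1 : g2 ∘ g1 = g)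
    (e2 : g1 ∘ f = gf) (e3 : g2 ∘ gf = h) m n p :
  asci1 e m (tns e1 n p)
  = uinv (galpha f g1 g2) *: tns (M := MN) e3 (tns e2 m n) p.
Proof.
by case: _ / e2 e3 => e3; rewrite /asci1 plift_gen /asci1_gen /= (tns_irr _ e3).
Qed.

Lemma asci_compat (X Z : C) (h : smor X Z) :
  compat (@trel _ _ _ M NP X Z h) (fun t => asci1 (tg_e t) (tg_x t) (tg_y t)).
Proof.
apply: tns_compat => [W a b e' y|W a b e' x|W W' a s b sa bs e1 e2 e3 e4 m d t] /=.
- exact: asci1_linl.
- exact: asci1_linr.
move: t; apply: tns_ext => [||V p r e5 n l].
- exact: asci1_linr.
- apply: lin_scale; apply: (lin_comp (@asci1_linr _ _ _ _ _ _ e4 m)).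
  exact: lactT_lin.
have e6 := factor_l e2 e5; have e7 := factor_l e3 e5.
have e8 : (p ∘ s) ∘ a = p ∘ sa by rewrite -e1 scompA.
rewrite (lactT_tns _ _ erefl e7) (linZ (@asci1_linr _ _ _ _ _ _ e4 m)).
rewrite (asci1_tns _ _ erefl e6) (asci1_tns _ _ e8 e6).
rewrite (tns_bal e1 erefl erefl e8) (tns_Zl (M := MN)) !scalerA; congr (_ *: _).
have hc := cocycle a s p r e1 erefl e5.
scal hc.
Qed.

Definition asci_fun (X Z : C) (h : smor X Z) : tmod M NP h -> tmod MN P h :=
  plift (@asci_compat X Z h).

Lemma asci_lin (X Z : C) (h : smor X Z) : linear (@asci_fun X Z h).
Proof. exact: plift_linear. Qed.

Lemma asci_tns (X Y W Z : C) (f : smor X Y) (g1 : smor Y W) (g2 : smor W Z)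
    (g : smor Y Z) (h : smor X Z) gf (e : g ∘ f = h) (e1 : g2 ∘ g1 = g)
    (e2 : g1 ∘ f = gf) (e3 : g2 ∘ gf = h) m n p :
  asci_fun (tns (N := NP) e m (tns e1 n p))
  = uinv (galpha f g1 g2) *: tns (M := MN) e3 (tns e2 m n) p.
Proof. by rewrite /asci_fun plift_gen /=; exact: asci1_tns. Qed.

Lemma ascK (X Z : C) (h : smor X Z) t : asci_fun (asc_map X Z h t) = t.
Proof.
move: t; apply: tns_ext_l => [||V W p q pq r e5 e6 m n l] /=.
- apply: (lin_comp (@asci_lin _ _ _)); exact: asc_lin.
- exact: lin_id.
rewrite (asc_tns _ _ erefl (factor_r e5 e6)) (linZ (@asci_lin _ _ _)).
by rewrite (asci_tns _ _ e6 e5) scalerA uvalK scale1r.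
Qed.

Lemma ascVK (X Z : C) (h : smor X Z) t : asc_map X Z h (asci_fun t) = t.
Proof.
move: t; apply: tns_ext_r => [||V W p q r qr e5 e6 m n l] /=.
- apply: (lin_comp (@asc_lin _ _ _)); exact: asci_lin.
- exact: lin_id.
rewrite (asci_tns _ _ erefl (factor_l e5 e6)) (linZ (@asc_lin _ _ _)).
by rewrite (asc_tns _ _ e6 e5) scalerA mulrC uvalK scale1r.
Qed.

Definition associator :
  @iso (bimCat A E) (tensBim (tensBim M N) P) (tensBim M (tensBim N P)) :=
  bimIso ascK ascVK.

End Assoc.

Definition BimData : bicatData :=
  @BicatData galg bimCat regBim tensFun
    (fun A B D E M N P => associator M N P)
    (fun A B M => lunitor M) (fun A B M => runitor M).

Section Coherence.
Variables A B D E : galg.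

Lemma asc_natural (M M' : gbimod A B) (N N' : gbimod B D) (P P' : gbimod D E)
    (u : bimap M M') (v : bimap N N') (w : bimap P P') :
  bimComp (asc_map M' N' P') (tensMap (tensMap u v) w)
  = bimComp (tensMap u (tensMap v w)) (asc_map M N P).
Proof.
apply: bimapP => X Z h; apply: tns_ext_l => [||V W p q pq r e5 e6 m n l] /=.
- apply: (lin_comp (@asc_lin _ _ _ _ _ _ _ _ _ _)).
  exact: (@tensMap_lin _ _ _ _ _ _ _ (tensMap u v) w).
- apply: (lin_comp (@tensMap_lin _ _ _ _ _ _ _ u (tensMap v w) _ _ _)).
  exact: asc_lin.
rewrite (tensMap_tns (tensMap u v) w) /= tensMap_tns.
have e7 := factor_r e5 e6.
rewrite !(asc_tns _ _ erefl e7) (linZ (@tensMap_lin _ _ _ _ _ _ _ _ _ _ _ _)).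
by rewrite (tensMap_tns u (tensMap v w)) /= tensMap_tns.
Qed.

Lemma lunit_natural (M M' : gbimod A B) (u : bimap M M') :
  bimComp (lunit_map M') (tensMap (bimId (regBim A)) u)
  = bimComp u (lunit_map M).
Proof.
apply: bimapP => X Z h; apply: tns_ext => [||V p q e a m] /=.
- apply: (lin_comp (@lunit_lin _ _ _ _ _ _)); exact: tensMap_lin.
- apply: (lin_comp (@bm_lin _ _ _ _ u _ _ _)); exact: lunit_lin.
by rewrite tensMap_tns !lunit_tns bm_lact.
Qed.

Lemma runit_natural (M M' : gbimod A B) (u : bimap M M') :
  bimComp (runit_map M') (tensMap u (bimId (regBim B)))
  = bimComp u (runit_map M).
Proof.
apply: bimapP => X Z h; apply: tns_ext => [||V p q e a m] /=.
- apply: (lin_comp (@runit_lin _ _ _ _ _ _)); exact: tensMap_lin.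
- apply: (lin_comp (@bm_lin _ _ _ _ u _ _ _)); exact: runit_lin.
by rewrite tensMap_tns !runit_tns bm_ract.
Qed.

Lemma asc_triangle (M : gbimod A B) (N : gbimod B D) :
  bimComp (tensMap (bimId M) (lunit_map N)) (asc_map M (regBim B) N)
  = tensMap (runit_map M) (bimId N).
Proof.
apply: bimapP => X Z h; apply: tns_ext_l => [||V W p q pq r e5 e6 m b n] /=.
- apply: (lin_comp (@tensMap_lin _ _ _ _ _ _ _ _ _ _ _ _)); exact: asc_lin.
- exact: (@tensMap_lin _ _ _ _ _ _ _ (runit_map M) (bimId N)).
rewrite (tensMap_tns (runit_map M) (bimId N)) /= runit_tns.
have e7 := factor_r e5 e6.
rewrite (asc_tns _ _ erefl e7) (linZ (@tensMap_lin _ _ _ _ _ _ _ _ _ _ _ _)).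
by rewrite (tensMap_tns (bimId M) (lunit_map N)) /= lunit_tns (tns_bal e6 e5 erefl e7).
Qed.

Variable F : galg.

Lemma asc_pentagon (M : gbimod A B) (N : gbimod B D) (P : gbimod D E)
    (Q : gbimod E F) :
  bimComp (asc_map M N (tensBim P Q)) (asc_map (tensBim M N) P Q)
  = bimComp (bimComp (tensMap (bimId M) (asc_map N P Q))
                     (asc_map M (tensBim N P) Q))
            (tensMap (asc_map M N P) (bimId Q)).
Proof.
apply: bimapP => X Z h.
have l1 := @tensMap_lin _ _ _ _ _ _ _ (asc_map M N P) (bimId Q) X Z h.
have l2 := @tensMap_lin _ _ _ _ _ _ _ (bimId M) (asc_map N P Q) X Z h.
have l3 := @asc_lin _ _ _ _ (tensBim M N) P Q X Z h.
have l4 := @asc_lin _ _ _ _ M N (tensBim P Q) X Z h.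
have l5 := @asc_lin _ _ _ _ M (tensBim N P) Q X Z h.
apply: tns_ext => [||Y f g e t q] /=.
- exact: (lin_comp l4 l3).
- exact: (lin_comp l2 (lin_comp l5 l1)).
have l6 := @tns_linl _ _ _ (tensBim (tensBim M N) P) Q _ _ _ _ _ _ e q.
have l7 := @tns_linl _ _ _ (tensBim M (tensBim N P)) Q _ _ _ _ _ _ e q.
move: t; apply: tns_ext_l => [||V W a b ba c e1 e2 m n p].
- exact: (lin_comp (lin_comp l4 l3) l6).
- exact: (lin_comp (lin_comp l2 (lin_comp l5 l1)) l6).
rewrite (tensMap_tns (asc_map M N P) (bimId Q)) /=.
have e3 := factor_r e1 e2; have e4 := factor_r e e1.
have e5 : (g ∘ (c ∘ b)) ∘ a = h by rewrite -e -e3 !scompA.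
have e6 : (g ∘ c) ∘ b = g ∘ (c ∘ b) by rewrite scompA.
rewrite (asc_tns _ _ erefl e4) (linZ l4) (asc_tns _ _ e6 e5) (asc_tns _ _ erefl e3).
rewrite (linZ l7) (linZ l5) (asc_tns _ _ erefl e5) !(linZ l2).
rewrite (tensMap_tns (bimId M) (asc_map N P Q)) /= (asc_tns _ _ erefl e6).
rewrite (tns_Zr (N := tensBim N (tensBim P Q))) !scalerA; congr (_ *: _).
have hc := cocycle a b c g e2 erefl erefl.
scal hc.
Qed.

End Coherence.

Definition Bim : bicategory.
Proof.
refine (@Bicategory BimData _ _ _ _ _).
- move=> A B D E M M' N N' P P' u v w; exact: asc_natural.
- move=> A B M M' u; exact: lunit_natural.
- move=> A B M M' u; exact: runit_natural.
- move=> A B D E F M N P Q; exact: asc_pentagon.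
- move=> A B D M N; exact: asc_triangle.
Defined.

Section HH0.
Variables (eps : looper C) (A : galg).

(** The component of degree [t] of [HH0(A, M)]: the direct sum of the [M_f]
    over endomorphisms [f] of class [t], modulo the relations. Only these
    components and only the relations with both [ract m a] and [lact a m]
    defined are retained: a product of elements of non-composable degrees is
    zero, so the other relations only involve, and kill, elements whose degree
    is not an endomorphism, which have no class in [Tr C]. *)
Section Component.
Variables (M : gbimod A A) (t : Tr C).

Record hgen := HGen {
  hg_ob : C;
  hg_f : smor hg_ob hg_ob;
  hg_e : tr hg_f = t;
  hg_m : M _ _ hg_f
}.

Inductive hrel : lterm k hgen -> lterm k hgen -> Prop :=
| hrel_lin X (f : smor X X) (e : tr f = t) c m m' :
    hrel (LGen k (HGen e (c *: m + m')))
         (LAdd (LScale c (LGen k (HGen e m))) (LGen k (HGen e m')))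
| hrel_tr X Y (f : smor X Y) (g : smor Y X) gf fg (e1 : g ∘ f = gf)
    (e2 : f ∘ g = fg) (e3 : tr gf = t) (e4 : tr fg = t)
    (m : M _ _ f) (a : A _ _ g) :
    hrel (LGen k (HGen e3 (ract e1 m a)))
         (LScale (uval (leps eps f g)) (LGen k (HGen e4 (lact e2 a m)))).

Definition HH0mod : lmodType k := pres hrel.
Definition hh (X : C) (f : smor X X) (e : tr f = t) (m : M _ _ f) : HH0mod :=
  pgen hrel (HGen e m).

End Component.

Definition HH0obj (M : gbimod A A) : Tr C -> lmodType k := HH0mod M.

Section HH0Map.
Variables (M N : gbimod A A) (u : bimap M N).

Lemma HH0_compat (t : Tr C) :
  compat (@hrel M t) (fun x => hh (hg_e x) (u _ _ _ (hg_m x))).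
Proof.
move=> x y [X f e c m m'|X Y f g gf fg e1 e2 e3 e4 m a] /=.
- by rewrite bm_lin; exact: (pres_rel (hrel_lin e c _ _)).
- by rewrite bm_ract bm_lact; exact: (pres_rel (hrel_tr e1 e2 e3 e4 _ _)).
Qed.

Definition HH0map : modMap (HH0obj M) (HH0obj N) :=
  ModMap (fun t => plift_linear (@HH0_compat t)).

Lemma HH0map_hh (t : Tr C) (X : C) (f : smor X X) (e : tr f = t) m :
  HH0map t (hh e m) = hh e (u _ _ _ m).
Proof. exact: plift_gen. Qed.

End HH0Map.

Definition HH0 : functor (bimCat A A) (GrMod k (Tr C)).
Proof.
refine (@Functor (bimCat A A) (GrMod k (Tr C)) HH0obj HH0map _ _).
- move=> M; apply: modMapP => t.
  apply: pres_ext => [||[X f e m]]; [exact: (@mm_lin _ _ _ _ (HH0map (bimId M)) t)|exact: lin_id|].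
  exact: (HH0map_hh (bimId M)).
- move=> M N P u v; apply: modMapP => t.
  apply: pres_ext => [||[X f e m]].
    exact: (@mm_lin _ _ _ _ (HH0map (bimComp v u)) t).
    exact: (lin_comp (@mm_lin _ _ _ _ (HH0map v) t) (@mm_lin _ _ _ _ (HH0map u) t)).
  rewrite (HH0map_hh (bimComp v u)).
  exact: (esym (etrans (congr1 (HH0map v t) (HH0map_hh u e m)) (HH0map_hh v e _))).
Defined.

End HH0.

End Graded.

(* Main.v *)
(** The isomorphism [theta] sends the class of [m ⊗ n] to
    [eps |m| |n|] times the class of [n ⊗ m]. The looper identity on the loop
    [(f, g, h)] is what makes this compatible with the balancing of [m b ⊗ n],
    with the trace relation of [(m ⊗ n) a], and with the hexagon; the unit laws
    are the trace relation itself, and [eps f g * eps g f = 1] makes [theta]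
    its own inverse. *)

Require Import Defs.
From mathcomp Require Import all_boot all_algebra.
From mathcomp Require Import boolp ring.

Set Implicit Arguments.
Unset Strict Implicit.
Unset Printing Implicit Defensive.

Import GRing.Theory.
Local Open Scope ring_scope.
Local Open Scope cat_scope.

(** * Scalar identities for the looper *)

Section Looper.
Variables (k : comPzRingType) (C : gradingCat k) (eps : looper C).

Lemma leps_swapK (X Y : C) (f : smor X Y) (g : smor Y X) :
  uval (leps eps f g) * uval (leps eps g f) = 1.
Proof. by rewrite -(leps_inv eps f g) uvalK. Qed.

(** The looper identity, with units moved so that both sides match the two
    composites of the hexagon. *)
Lemma leps_hexagon (X Y Z : C) (f : smor X Y) (g : smor Y Z) (h : smor Z X)
    gf hg fh (e1 : g ∘ f = gf) (e2 : h ∘ g = hg) (e3 : f ∘ h = fh) :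
  uval (galpha f g h) * uval (leps eps f hg) * uval (galpha g h f)
  = uval (leps eps gf h) * uinv (galpha h f g) * uval (leps eps fh g).
Proof.
case: _ / e1; case: _ / e2; case: _ / e3.
have := uvalK (galpha h f g); have := leps_swapK h (g ∘ f).
have := leps_swapK g (f ∘ h); have := leps_loop eps f g h.
set p := uval (galpha h f g); set p' := uinv _.
set q := leps eps (g ∘ f) h; set r := leps eps (f ∘ h) g.
(* Multiplying the right side by the loop product, which is 1, cancels its two looper values and its
   inverse associator. *)
move=> hl h1 h2 h3; rewrite -[RHS]mulr1 -hl -/p; ring: h1 h2 h3.
Qed.

End Looper.

(** Swapping the two factors of a loop keeps its trace class, so theta preserves the grading. *)
Lemma tr_factor (C : smallCat) (X Y : C) (f : smor X Y) (g : smor Y X) h t :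
  g ∘ f = h -> tr h = t -> tr (f ∘ g) = t.
Proof. by move=> <- <-; rewrite tr_comm. Qed.

Lemma modCompE (k : comPzRingType) (S : Type) (U V W : S -> lmodType k)
    (v : modMap V W) (u : modMap U V) s x : modComp v u s x = v s (u s x).
Proof. by []. Qed.

(** * Relations and extensionality in one degree of Hochschild homology *)

Section HH0Theory.
Variables (k : comPzRingType) (C : gradingCat k) (eps : looper C) (A : galg C).
Variables (M : gbimod A A) (t : Tr C).

Lemma hh_lin (X : C) (f : smor X X) (e : tr f = t) :
  linear (fun m : M _ _ f => hh eps e m).
Proof. by move=> c m m'; exact: (pres_rel (hrel_lin eps e c m m')). Qed.

Lemma hhZ (X : C) (f : smor X X) (e : tr f = t) c (m : M _ _ f) :
  hh eps e (c *: m) = c *: hh eps e m.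
Proof. exact: (linZ (hh_lin e)). Qed.

Lemma hh_tr (X Y : C) (f : smor X Y) (g : smor Y X) gf fg (e1 : g ∘ f = gf)
    (e2 : f ∘ g = fg) (e3 : tr gf = t) (e4 : tr fg = t)
    (m : M _ _ f) (a : A _ _ g) :
  hh eps e3 (ract e1 m a) = uval (leps eps f g) *: hh eps e4 (lact e2 a m).
Proof. exact: (pres_rel (hrel_tr eps e1 e2 e3 e4 m a)). Qed.

Lemma hh_ext (V : lmodType k) (F G : HH0mod eps M t -> V) :
  linear F -> linear G ->
  (forall (X : C) (f : smor X X) (e : tr f = t) m,
     F (hh eps e m) = G (hh eps e m)) -> F =1 G.
Proof. by move=> hF hG H; apply: pres_ext => // -[X f e m]; exact: H. Qed.

End HH0Theory.

(** * Construction of theta by descent to the quotient *)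

Section HH0Tensor.
Variables (k : comPzRingType) (C : gradingCat k) (eps : looper C).
Variables (A B : galg C) (M : gbimod A B) (N : gbimod B A).
Local Notation MN := (tensBim M N).
Local Notation NM := (tensBim N M).

Section Degree.
Variable t : Tr C.

Lemma hh_tns_ext (V : lmodType k) (F G : HH0mod eps MN t -> V) :
  linear F -> linear G ->
  (forall (X Y : C) (h : smor X X) (f : smor X Y) (g : smor Y X)
     (e1 : g ∘ f = h) (e : tr h = t) m n,
     F (hh (M := MN) eps e (tns e1 m n)) = G (hh (M := MN) eps e (tns e1 m n))) ->
  F =1 G.
Proof.
move=> hF hG H; apply: hh_ext => // X h e; apply: tns_ext => [||Y f g e1 m n].
- exact: (lin_comp hF (hh_lin (M := MN) eps e)).
- exact: (lin_comp hG (hh_lin (M := MN) eps e)).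
- exact: H.
Qed.

(** Theta descends in two stages: first through the balancing over [B] for a fixed endomorphism [h],
    then through the trace relations, which link different endomorphisms of class [t]. *)
Definition theta_gen (X : C) (h : smor X X) (e : tr h = t) (s : tgen M N h) :
    HH0mod eps NM t :=
  uval (leps eps (tg_f s) (tg_g s))
  *: hh (M := NM) eps (tr_factor (tg_e s) e) (tns erefl (tg_y s) (tg_x s)).

(** After the swap, the element of [B] acts at the outer ends of [N ⊗ M], so balancing in [M ⊗ N]
    becomes the trace relation over [B]. *)
Lemma theta_gen_compat (X : C) (h : smor X X) (e : tr h = t) :
  compat (@trel _ _ _ _ _ M N X X h) (theta_gen e).
Proof.
apply: tns_compat => [W p q e' y|W p q e' x|W W' m b n bm nb e1 e2 e3 e4 x y z];
  rewrite /theta_gen /=.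
- apply: lin_scale; apply: (lin_comp (hh_lin (M := NM) eps _)); exact: tns_linr.
- apply: lin_scale; apply: (lin_comp (hh_lin (M := NM) eps _)); exact: tns_linl.
have e5 : b ∘ (m ∘ n) = bm ∘ n by rewrite -e1 scompA.
have e6 : (m ∘ n) ∘ b = m ∘ nb by rewrite -e3 scompA.
have := hh_tr (M := NM) eps e5 e6 (tr_factor e2 e) (tr_factor e4 e)
  (tns erefl z x) y.
rewrite /= (ractT_tns _ _ e1 erefl) (lactT_tns _ _ e3 erefl).
rewrite !(hhZ (M := NM) eps) scalerA.
(* The looper value is the coefficient of theta on [x y ⊗ z]; the inverse associator cancels the one
   produced by the right action on [z ⊗ x]. *)
move=> /(congr1 (fun v => (uval (leps eps bm n) * uinv (galpha n m b)) *: v)).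
rewrite !scalerA -mulrA [uinv _ * uval _]mulrC uvalK mulr1 => ->; congr (_ *: _).
by rewrite -(leps_hexagon eps e1 e3 erefl) -mulrA uvalK mulr1.
Qed.

Definition theta1 (X : C) (h : smor X X) (e : tr h = t) : MN _ _ h -> HH0mod eps NM t :=
  plift (theta_gen_compat e).

Lemma theta1_lin (X : C) (h : smor X X) (e : tr h = t) : linear (theta1 e).
Proof. exact: plift_linear. Qed.

(** Leaving [h'] and the proofs free lets one class be matched under any bracketing of its
    degree. *)
Lemma theta1_tns (X Y : C) (h : smor X X) (f : smor X Y) (g : smor Y X) h'
    (e1 : g ∘ f = h) (e2 : f ∘ g = h') (e : tr h = t) (e' : tr h' = t) m n :
  theta1 e (tns e1 m n)
  = uval (leps eps f g) *: hh (M := NM) eps e' (tns e2 n m).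
Proof.
case: _ / e2 e' => e'; rewrite /theta1 plift_gen /theta_gen /=.
by rewrite (Prop_irrelevance e' (tr_factor e1 e)).
Qed.

(** Dually, the element of [A] moves from the outer ends of [M ⊗ N] to the middle of [N ⊗ M], so the
    trace relation becomes balancing over [A]. *)
Lemma theta_compat :
  compat (@hrel _ _ eps _ MN t) (fun x => theta1 (hg_e x) (hg_m x)).
Proof.
move=> ? ? [X f e c m m'|X Y f g gf fg e1 e2 e3 e4 x a] /=; first exact: theta1_lin.
move: x; apply: tns_ext => [||W m n e5 x y].
- apply: (lin_comp (@theta1_lin _ _ _)); exact: ractT_lin.
- apply: lin_scale; apply: (lin_comp (@theta1_lin _ _ _)); exact: lactT_lin.
have e6 : (g ∘ n) ∘ m = gf by rewrite -e1 -e5 scompA.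
have e7 : n ∘ (m ∘ g) = fg by rewrite -e2 -e5 scompA.
have e8 : (m ∘ g) ∘ n = m ∘ (g ∘ n) by rewrite scompA.
rewrite (ractT_tns _ _ erefl e6) (lactT_tns _ _ erefl e7) !(linZ (@theta1_lin _ _ _)).
have e9 : tr (m ∘ (g ∘ n)) = t by rewrite tr_comm e6.
rewrite (theta1_tns _ erefl _ e9) (theta1_tns _ e8 _ e9).
rewrite (tns_bal erefl erefl erefl e8) (hhZ (M := NM) eps) !scalerA; congr (_ *: _).
rewrite -(leps_hexagon eps e5 erefl erefl); ring.
Qed.

End Degree.

Definition theta_map : modMap (HH0obj eps MN) (HH0obj eps NM) :=
  ModMap (fun t => plift_linear (@theta_compat t)).

Lemma theta_hh t (X Y : C) (h : smor X X) (f : smor X Y) (g : smor Y X) h'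
    (e1 : g ∘ f = h) (e2 : f ∘ g = h') (e : tr h = t) (e' : tr h' = t) m n :
  theta_map t (hh (M := MN) eps e (tns e1 m n))
  = uval (leps eps f g) *: hh (M := NM) eps e' (tns e2 n m).
Proof. by rewrite [LHS]plift_gen; exact: theta1_tns. Qed.

End HH0Tensor.

(** * Invertibility, naturality, hexagon and unit laws of theta *)

Section Shadow.
Variables (k : comPzRingType) (C : gradingCat k) (eps : looper C).

Lemma theta_lin (A B : galg C) (M : gbimod A B) (N : gbimod B A) t :
  linear (theta_map eps M N t).
Proof. exact: mm_lin. Qed.
Arguments theta_lin {A B} M N t.

Lemma HH0map_lin (A : galg C) (M N : gbimod A A) (u : bimap M N) t :
  linear (HH0map eps u t).
Proof. exact: mm_lin. Qed.
Arguments HH0map_lin {A M N} u t.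

Lemma HH0map_tensMap (A B : galg C) (M M' : gbimod A B) (N N' : gbimod B A)
    (u : bimap M M') (v : bimap N N') t (X Y : C) (f : smor X Y) (g : smor Y X) h
    (e1 : g ∘ f = h) (e : tr h = t) m n :
  HH0map eps (tensMap u v) t (hh (M := tensBim M N) eps e (tns e1 m n))
  = hh (M := tensBim M' N') eps e (tns e1 (u _ _ _ m) (v _ _ _ n)).
Proof. by rewrite HH0map_hh /= tensMap_tns. Qed.

Lemma HH0map_lunit (A : galg C) (M : gbimod A A) t (X Y : C) (f : smor X Y)
    (g : smor Y X) h (e1 : g ∘ f = h) (e : tr h = t) a m :
  HH0map eps (lunit_map M) t
    (hh (M := tensBim (regBim A) M) eps e (tns (M := regBim A) e1 a m))
  = hh eps e (lact e1 a m).
Proof. by rewrite HH0map_hh /= lunit_tns. Qed.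

Lemma HH0map_runit (A : galg C) (M : gbimod A A) t (X Y : C) (f : smor X Y)
    (g : smor Y X) h (e1 : g ∘ f = h) (e : tr h = t) m a :
  HH0map eps (runit_map M) t
    (hh (M := tensBim M (regBim A)) eps e (tns (N := regBim A) e1 m a))
  = hh eps e (ract e1 m a).
Proof. by rewrite HH0map_hh /= runit_tns. Qed.

Section Assoc.
Variables (A B D : galg C) (M : gbimod A B) (N : gbimod B D) (P : gbimod D A).
Variables (t : Tr C) (X Y Z : C) (f : smor X Y) (g : smor Y Z) (i : smor Z X).
Variables (gf : smor X Z) (ig : smor Y X) (h : smor X X).
Hypotheses (e1 : g ∘ f = gf) (e2 : i ∘ gf = h) (e3 : i ∘ g = ig)
  (e4 : ig ∘ f = h) (e : tr h = t).

Lemma HH0map_asc m n p :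
  HH0map eps (asc_map M N P) t
    (hh (M := tensBim (tensBim M N) P) eps e
       (tns (M := tensBim M N) e2 (tns e1 m n) p))
  = uval (galpha f g i)
    *: hh (M := tensBim M (tensBim N P)) eps e
         (tns (N := tensBim N P) e4 m (tns e3 n p)).
Proof.
by rewrite HH0map_hh /= (asc_tns e2 e1 e3 e4) (hhZ (M := tensBim _ _) eps).
Qed.

Lemma HH0map_asci m n p :
  HH0map eps (ibwd (associator M N P)) t
    (hh (M := tensBim M (tensBim N P)) eps e
       (tns (N := tensBim N P) e4 m (tns e3 n p)))
  = uinv (galpha f g i)
    *: hh (M := tensBim (tensBim M N) P) eps e
         (tns (M := tensBim M N) e2 (tns e1 m n) p).
Proof.
by rewrite HH0map_hh /= (asci_tns e4 e3 e1 e2) (hhZ (M := tensBim _ _) eps).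
Qed.

End Assoc.

(** Exchanging [M] and [N] here gives the other inverse law as well. *)
Lemma theta_mapK (A B : galg C) (M : gbimod A B) (N : gbimod B A) :
  modComp (theta_map eps N M) (theta_map eps M N) = modId _.
Proof.
apply: modMapP => t; apply: hh_tns_ext => [||X Y h f g e1 e m n].
- exact: (lin_comp (theta_lin N M t) (theta_lin M N t)).
- exact: lin_id.
have e' := tr_factor e1 e.
rewrite modCompE (theta_hh eps e1 erefl e e') (linZ (theta_lin _ _ _)).
by rewrite (theta_hh eps erefl e1 e' e) scalerA leps_swapK scale1r.
Qed.

Definition theta (A B : galg C) (M : gbimod A B) (N : gbimod B A) :
  @iso (GrMod k (Tr C)) (HH0obj eps (tensBim M N)) (HH0obj eps (tensBim N M)) :=
  @Iso (GrMod k (Tr C)) _ _ (theta_map eps M N) (theta_map eps N M)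
    (theta_mapK M N) (theta_mapK N M).

(** Bimodule maps preserve degrees, and the coefficient of theta depends only on degrees. *)
Lemma theta_natural (A B : galg C) (M M' : gbimod A B) (N N' : gbimod B A)
    (u : bimap M M') (v : bimap N N') :
  modComp (theta_map eps M' N') (HH0map eps (tensMap u v))
  = modComp (HH0map eps (tensMap v u)) (theta_map eps M N).
Proof.
apply: modMapP => t; apply: hh_tns_ext => [||X Y h f g e1 e m n].
- exact: (lin_comp (theta_lin M' N' t) (HH0map_lin (tensMap u v) t)).
- exact: (lin_comp (HH0map_lin (tensMap v u) t) (theta_lin M N t)).
have e' := tr_factor e1 e.
rewrite !modCompE HH0map_tensMap !(theta_hh eps e1 erefl e e').
by rewrite (linZ (HH0map_lin _ _)) HH0map_tensMap.
Qed.

(** Both composites send [(m ⊗ n) ⊗ p] to a multiple of [n ⊗ (p ⊗ m)]; the two scalars are the sides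
    of [leps_hexagon]. *)
Lemma theta_hexagon (A B D : galg C) (M : gbimod A B) (N : gbimod B D)
    (P : gbimod D A) :
  modComp (modComp (HH0map eps (asc_map N P M)) (theta_map eps M (tensBim N P)))
    (HH0map eps (asc_map M N P))
  = modComp (modComp (theta_map eps (tensBim P M) N)
      (HH0map eps (ibwd (associator P M N)))) (theta_map eps (tensBim M N) P).
Proof.
apply: modMapP => t.
have l1 := HH0map_lin (asc_map M N P) t.
have l2 := HH0map_lin (asc_map N P M) t.
have l3 := HH0map_lin (ibwd (associator P M N)) t.
have l4 := theta_lin M (tensBim N P) t.
have l5 := theta_lin (tensBim P M) N t.
have l6 := theta_lin (tensBim M N) P t.
apply: hh_ext => [||X h e x].
- exact: (lin_comp l2 (lin_comp l4 l1)).
- exact: (lin_comp l5 (lin_comp l3 l6)).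
have l7 := @hh_lin _ _ eps _ (tensBim (tensBim M N) P) _ _ _ e.
move: x; apply: tns_ext_l => [||Y Z f g gf i e1 e2 m n p].
- exact: (lin_comp (lin_comp l2 (lin_comp l4 l1)) l7).
- exact: (lin_comp (lin_comp l5 (lin_comp l3 l6)) l7).
have e3 := factor_r e1 e2; have e4 := tr_factor e3 e; have e5 := tr_factor e1 e.
(* These equations let the rebracketings of [(n ⊗ p) ⊗ m] and of [p ⊗ (m ⊗ n)] each stay in a single
   degree. *)
have e6 : (f ∘ i) ∘ g = f ∘ (i ∘ g) by rewrite scompA.
have e7 : g ∘ (f ∘ i) = gf ∘ i by rewrite -e2 scompA.
rewrite !modCompE (HH0map_asc e2 e1 erefl e3) (linZ l4) (linZ l2).
rewrite (theta_hh (N := tensBim N P) eps e3 erefl e e4) (linZ l2).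
rewrite (HH0map_asc erefl erefl erefl e6).
rewrite (theta_hh (M := tensBim M N) eps e1 erefl e e5) (linZ l3) (linZ l5).
rewrite (HH0map_asci erefl e7 e2 erefl) (linZ l5).
rewrite (theta_hh (M := tensBim P M) eps e7 e6 e5 e4) !scalerA.
by rewrite (leps_hexagon eps e2 erefl erefl).
Qed.

Lemma theta_lunit (A : galg C) (M : gbimod A A) :
  modComp (HH0map eps (lunit_map M)) (theta_map eps M (regBim A))
  = HH0map eps (runit_map M).
Proof.
apply: modMapP => t; apply: hh_tns_ext => [||X Y h f g e1 e m a].
- exact: (lin_comp (HH0map_lin (lunit_map M) t) (theta_lin M (regBim A) t)).
- exact: HH0map_lin.
have e' := tr_factor e1 e.
rewrite modCompE (theta_hh (N := regBim A) eps e1 erefl e e').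
rewrite (linZ (HH0map_lin _ _)) HH0map_lunit HH0map_runit.
by rewrite (hh_tr eps e1 erefl e e').
Qed.

(** The trace relation turns [m a] back into [a m], and its looper value cancels the coefficient of
    theta. *)
Lemma theta_runit (A : galg C) (M : gbimod A A) :
  modComp (HH0map eps (runit_map M)) (theta_map eps (regBim A) M)
  = HH0map eps (lunit_map M).
Proof.
apply: modMapP => t; apply: hh_tns_ext => [||X Y h f g e1 e a m].
- exact: (lin_comp (HH0map_lin (runit_map M) t) (theta_lin (regBim A) M t)).
- exact: HH0map_lin.
have e' := tr_factor e1 e.
rewrite modCompE (theta_hh (M := regBim A) eps e1 erefl e e').
rewrite (linZ (HH0map_lin _ _)) HH0map_lunit HH0map_runit.
by rewrite (hh_tr eps erefl e1 e' e) scalerA leps_swapK scale1r.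
Qed.

End Shadow.

Theorem proposition3p21 (k : comPzRingType) (C : gradingCat k) (eps : looper C) :
  exists S : @shadow (Bim C) (GrMod k (Tr C)) (fun A : galg C => HH0 eps A),
    symmetric_shadow S.
Proof.
unshelve eexists.
  refine (@Shadow (Bim C) (GrMod k (Tr C)) (fun A : galg C => HH0 eps A)
    (@theta k C eps) _ _ _ _).
- move=> A B M M' N N' u v; exact: theta_natural.
- move=> A B D M N P; exact: theta_hexagon.
- move=> A M; exact: theta_lunit.
- move=> A M; exact: theta_runit.
(* Symmetry is definitional: the inverse stored in [theta M N] is the forward map of [theta N M]. *)
by [].
Qed.
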